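(* Let $D$ be the closed unit disk in $\mathbb{R}^2$ with $\omega=dx\wedge dy$, $o=(0,0)$, $G_o=\{g\in\mathrm{Symp}(D)\mid g(o)=o\}$, $\widetilde{G_o}$ its universal covering group (for the $C^\infty$-topology) and $p:\widetilde{G_o}\to G_o$ the projection. Then \[ p^*\overline{\sigma}-S=\pi\,\widetilde{\mathrm{rot}}\quad\text{as maps }\widetilde{G_o}\to\mathbb{R}, \] where $\widetilde{\mathrm{rot}}:\widetilde{G_o}\to\mathbb{R}$ is the pullback of Poincaré's translation number by the surjection $\widetilde{G_o}\to\widetilde{\mathrm{Diff}_+(S^1)}$ induced by restriction to the boundary.
   Context: $\mathrm{Symp}(D)$ is the group of all symplectomorphisms of $D$ (not necessarily the identity on $\partial D$). For a $1$-form $\eta$ with $d\eta=\omega$ and a path $\gamma$ from $o$ to a point of $\partial D$, define $\sigma_{\eta,\gamma}:G_o\to\mathbb{R}$ by $\sigma_{\eta,\gamma}(g)=\int_\gamma g^*\eta-\eta$. It is a quasi-morphism, and its homogenization $\overline{\sigma}(g)=\lim_{n\to\infty}\sigma_{\eta,\gamma}(g^n)/n$ is independent of $\eta,\gamma$. For a path $g_t$ in $G_o$ with $g_0=\mathrm{id}$, let $X_t=(\partial g_t/\partial t)\circ g_t^{-1}$ and put $S(g_t)=\int_0^1\int_\gamma i_{X_t}\omega\,dt$; this depends only on the homotopy class rel endpoints of $g_t$ and defines a homomorphism $S:\widetilde{G_o}\to\mathbb{R}$. Identify $S^1=\partial D$ with $\mathbb{R}/2\pi\mathbb{Z}$; elements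 of $\widetilde{\mathrm{Diff}_+(S^1)}$ are diffeomorphisms $\widetilde{\varphi}$ of $\mathbb{R}$ with $\widetilde{\varphi}(\theta+2\pi)=\widetilde{\varphi}(\theta)+2\pi$, and $\widetilde{\mathrm{rot}}(\widetilde{\varphi})=\lim_{n\to\infty}\widetilde{\varphi}^n(0)/(2\pi n)$. *)

(* Defs.v *)
From HB Require Import structures.
From mathcomp Require Import all_boot all_order all_algebra.
From mathcomp Require Import all_classical all_reals all_analysis.
Set Implicit Arguments. Unset Strict Implicit. Unset Printing Implicit Defensive.
Import Order.TTheory GRing.Theory Num.Theory.
Import numFieldNormedType.Exports.
Local Open Scope classical_set_scope.
Local Open Scope ring_scope.

Section Defs.
Variable R : realType.

(* C^k on a set U, via iterated directional derivatives (Frechet-free, but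
   used only on open sets U, where this is the usual notion). *)
Fixpoint Ck {V W : normedModType R} (k : nat) (U : set V) (f : V -> W) : Prop :=
  match k with
  | 0 => {in U, continuous f}
  | k.+1 => {in U, continuous f} /\
            (forall x v, U x -> derivable f x v) /\
            (forall v, Ck k U (fun x => 'D_v f x))
  end.

Definition smooth_near {V W : normedModType R} (A : set V) (f : V -> W) : Prop :=
  exists U : set V, open U /\ A `<=` U /\ forall k, Ck k U f.

Definition disk : set (R * R) := [set p | p.1 ^+ 2 + p.2 ^+ 2 <= 1].
Definition circle : set (R * R) := [set p | p.1 ^+ 2 + p.2 ^+ 2 = 1].
Definition origin : R * R := (0, 0).

Definition jac (f : R * R -> R * R) (p : R * R) : R :=
  ('D_(1,0) f p).1 * ('D_(0,1) f p).2 - ('D_(0,1) f p).1 * ('D_(1,0) f p).2.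

Definition sympD (f finv : R * R -> R * R) : Prop :=
  smooth_near disk f /\ smooth_near disk finv /\
  (forall p, disk p -> disk (f p)) /\ (forall p, disk p -> disk (finv p)) /\
  (forall p, disk p -> finv (f p) = p) /\ (forall p, disk p -> f (finv p) = p) /\
  (forall p, disk p -> jac f p = 1).

Definition unit_interval : set R := `[0, 1]%classic.

Definition int01 (h : R -> R) : R := Rintegral lebesgue_measure `[0, 1] h.

(* a 1-form eta = P dx + Q dy is represented by eta p = (P p, Q p);
   pairing with a tangent vector *)
Definition pair1 (eta : R * R -> R * R) (p v : R * R) : R :=
  (eta p).1 * v.1 + (eta p).2 * v.2.

Definition lineint (eta : R * R -> R * R) (c : R -> R * R) : R :=
  int01 (fun s => pair1 eta (c s) ('D_1 c s)).

Definition primitive_omega (eta : R * R -> R * R) : Prop :=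
  smooth_near disk eta /\
  forall p, disk p -> ('D_(1,0) eta p).2 - ('D_(0,1) eta p).1 = 1.

(* sigma_{eta,gamma}(g) = int_gamma g^* eta - eta = int_{g o gamma} eta - int_gamma eta *)
Definition sigma (eta : R * R -> R * R) (gamma : R -> R * R) (g : R * R -> R * R) : R :=
  lineint eta (g \o gamma) - lineint eta gamma.

Definition sigma_bar eta gamma (g : R * R -> R * R) : R :=
  lim ((fun n : nat => sigma eta gamma (iter n g) / n%:R) @ \oo).

(* S(g_t) = int_0^1 int_gamma i_{X_t} omega dt, X_t = (d g_t/dt) o g_t^{-1},
   i_X (dx/\dy) = X^1 dy - X^2 dx *)
Definition vfield (g ginv : R -> R * R -> R * R) (t : R) (q : R * R) : R * R :=
  'D_1 (fun s => g s (ginv t q)) t.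

Definition S_path (gamma : R -> R * R) (g ginv : R -> R * R -> R * R) : R :=
  int01 (fun t => int01 (fun s =>
    (vfield g ginv t (gamma s)).1 * ('D_1 gamma s).2
    - (vfield g ginv t (gamma s)).2 * ('D_1 gamma s).1)).

Definition transl_number (Ft : R -> R) : R :=
  lim ((fun n : nat => iter n Ft 0 / (2 * pi * n%:R)) @ \oo).

End Defs.

Arguments disk {R}.
Arguments circle {R}.
Arguments origin {R}.
Arguments unit_interval {R}.

(* Main.v *)
Require Import Defs.
From HB Require Import structures.
From mathcomp Require Import all_boot all_order all_algebra.
From mathcomp Require Import all_classical all_reals all_analysis.
From mathcomp Require Import ring lra.
Set Implicit Arguments. Unset Strict Implicit. Unset Printing Implicit Defensive.
Import Order.TTheory GRing.Theory Num.Theory.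
Import numFieldNormedType.Exports.
Local Open Scope classical_set_scope.
Local Open Scope ring_scope.

(** Write [a x b] for the determinant of two plane vectors.  Let [eta] be a
    primitive of [omega] and [c] a path in [D].  Stokes' theorem on the cone
    [r c(s)] shows that [int_c eta] differs from [1/2 int c x c'] by a term
    which depends only on the end points and is bounded.  Stokes' theorem on
    the square [(t, s) |-> g_t(c(s))], for a path [c] from the origin to the
    boundary, gives
      [1/2 int (g_1 c) x (g_1 c)' - 1/2 int c x c' =
       1/2 int_t (d/dt g_t(c(1))) dtheta + int_t int_c beta_t],
    where [beta_t = g_t^* (i_{X_t} omega)].  The first term on the right is half
    the increment of the angle [F] of the boundary point.  The form [beta_t] is
    closed, since [det Dg_t = 1] for all [t], and vanishes on vectors tangent to
    the circle, so [int_c beta_t] is the same for all paths from the origin to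
    the boundary; taking [c = g_t^-1 gamma] identifies the second term with [S].
    Iterating, [sigma(g_1^n) = n S + (F_1^n(theta) - theta) / 2 + O(1)], and the
    claim follows after division by [n]. *)

(** * Integrals over the unit interval and Stokes on the square *)

(** The cone estimate makes iteration harmless: its end-point term is bounded uniformly over all
    iterates, so only 1/2 int c x c' has to be followed, and each application of [g 1] changes it by
    an exact amount. The flux part of that amount is the same at every step, and the angular parts
    telescope to the displacement of an orbit of [F 1]. A full turn of the boundary adds 2 pi to the
    angle, hence pi to sigma, and 1 to the translation number; this is the constant pi. The form
    beta_t kills tangent vectors because dg_t/dt and Dg_t v are then tangent to the circle at the
    same point, hence parallel. Two obstacles shape the proof. Smoothness is given by iterated
    directional derivatives, so the chain rule and the symmetry of mixed partials, on which Stokes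
    rests, must first be recovered. And the lift [F] is only a continuous choice of angles: its
    differentiability in t, its periodic displacement and its monotonicity are deduced from g. *)

Lemma continuous_pair (T U V : topologicalType) (f : T -> U) (g : T -> V) x :
  {for x, continuous f} -> {for x, continuous g} ->
  {for x, continuous (fun y => (f y, g y))}.
Proof. by move=> cf cg; exact: (@cvg_pair _ _ _ _ (nbhs (f x)) (nbhs (g x))). Qed.

Lemma continuous_for_comp (T U V : topologicalType) (f : T -> U) (g : U -> V) x :
  {for x, continuous f} -> {for f x, continuous g} ->
  {for x, continuous (fun y => g (f y))}.
Proof. exact: continuous_comp. Qed.

Section Calculus.
Variable R : realType.
Implicit Types (f g F : R -> R) (a b e k r s x : R).
Notation mu := (@lebesgue_measure R).

Lemma integrable_within a b f : {within `[a, b], continuous f} ->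
  mu.-integrable `[a, b] (EFin \o f).
Proof. by apply: continuous_compact_integrable; exact: segment_compact. Qed.

Lemma Rintegral_derive a b F f : a < b ->
  {within `[a, b], continuous f} -> {within `[a, b], continuous F} ->
  (forall x, a < x < b -> is_derive x 1 F (f x)) ->
  \int[mu]_(x in `[a, b]) f x = F b - F a.
Proof.
move=> ab cf cF dF; rewrite /Rintegral (continuous_FTC2 ab cf (F := F)) //.
  have [_ ca cb] := (continuous_within_itvP F ab).1 cF.
  split => // x; rewrite in_itv /= => /dF d; exact: (@ex_derive _ _ _ _ _ _ _ d).
by move=> x; rewrite in_itv /= => /dF d; rewrite derive1E (@derive_val _ _ _ _ _ _ _ d).
Qed.

(** Continuity is asked in the topology of the plane even at the edges; the integrands come from
    maps that are smooth on a neighbourhood. *)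
Definition square_continuous (W : topologicalType) (h : R -> R -> W) :=
  forall r s : R, 0 <= r <= 1 -> 0 <= s <= 1 -> {for (r, s), continuous (fun z : R * R => h z.1 z.2)}.

Lemma continuous_for_within (A : set R) f :
  (forall x, A x -> {for x, continuous f}) -> {within A, continuous f}.
Proof. by move=> cf; apply: continuous_in_subspaceT => x; rewrite inE; exact: cf. Qed.

Lemma square_continuous_slice2 (h : R -> R -> R) (r : R)   :
  square_continuous h -> 0 <= r <= 1 -> {within `[0, 1], continuous (h r)}.
Proof.
move=> ch r01; apply: continuous_for_within => s; rewrite /= in_itv /= => s01.
apply: (@continuous_for_comp _ _ _ (fun s => (r, s)) (fun z : R * R => h z.1 z.2)).
  by apply: continuous_pair; [exact: cvg_cst|exact: cvg_id].
exact: ch.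
Qed.

Lemma square_continuous_slice1 (h : R -> R -> R) (s : R) :
  square_continuous h -> 0 <= s <= 1 -> {within `[0, 1], continuous (h ^~ s)}.
Proof.
move=> ch s01; apply: continuous_for_within => r; rewrite /= in_itv /= => r01.
apply: (@continuous_for_comp _ _ _ (fun r => (r, s)) (fun z : R * R => h z.1 z.2)).
  by apply: continuous_pair; [exact: cvg_id|exact: cvg_cst].
exact: ch.
Qed.

(** Tube lemma: compactness of the segment makes the neighbourhood of [r0] independent of [s]. *)
Lemma square_continuous_near (h : R -> R -> R) (r0 e : R) : square_continuous h -> 0 <= r0 <= 1 -> 0 < e ->
  \forall r \near r0, forall s, 0 <= s <= 1 -> `|h r s - h r0 s| <= e.
Proof.
move=> ch r01 e0.
have /compact_near_coveringP cc := @segment_compact R 0 1.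
have := cc R (nbhs r0) (fun r s => `|h r s - h r0 s| <= e) _.
have H : forall x : R, `[0, 1]%classic x -> \forall x' \near x & i \near r0, `|h i x' - h r0 x'| <= e.
  move=> s; rewrite /= in_itv /= => s01.
  have /cvgrPdist_lt /(_ (e / 2)) := ch _ _ r01 s01.
  rewrite divr_gt0 // => /(_ isT) [[A B] /= [nA nB] AB].
  exists (B, A) => //= -[x i] [/= Bx Ai].
  have /= h1 := AB (i, x) (conj Ai Bx).
  have /= h2 := AB (r0, x) (conj (nbhs_singleton nA) Bx).
  rewrite (_ : _ - _ = (h r0 s - h r0 x) - (h r0 s - h i x)); last by ring.
  by rewrite (le_trans (ler_normB _ _))// [leRHS](splitr e) lerD // ltW.
move=> /(_ _ H); apply: filterS => r hr s s01; apply: hr.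
by rewrite /= in_itv.
Qed.

Lemma int01_ext f g : (forall x, 0 <= x <= 1 -> f x = g x) -> int01 f = int01 g.
Proof. by move=> fg; apply: eq_Rintegral => x; rewrite inE /= in_itv /=; exact: fg. Qed.

Lemma int01D f g : {within `[0, 1], continuous f} -> {within `[0, 1], continuous g} ->
  int01 (fun x => f x + g x) = int01 f + int01 g.
Proof. by move=> cf cg; rewrite /int01 RintegralD //; exact: integrable_within. Qed.

Lemma int01B f g : {within `[0, 1], continuous f} -> {within `[0, 1], continuous g} ->
  int01 (fun x => f x - g x) = int01 f - int01 g.
Proof. by move=> cf cg; rewrite /int01 RintegralB //; exact: integrable_within. Qed.

Lemma int01Z k f : {within `[0, 1], continuous f} ->
  int01 (fun x => k * f x) = k * int01 f.
Proof. by move=> cf; rewrite /int01 RintegralZl //; exact: integrable_within. Qed.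

Lemma int01_cst (k : R) : int01 (fun=> k) = k.
Proof.
by rewrite /int01 Rintegral_cst //= lebesgue_measure_itv /= lte01 oppr0 adde0 /= mulr1.
Qed.

Lemma int01_bound f e : {within `[0, 1], continuous f} ->
  (forall x, 0 <= x <= 1 -> `|f x| <= e) -> `|int01 f| <= e.
Proof.
move=> cf fe; apply: le_trans (le_normr_Rintegral _ (integrable_within cf)) _ => //.
rewrite -[leRHS]int01_cst; apply: le_Rintegral => //.
- by move/integrable_norm: (integrable_within cf); apply.
- by apply: integrable_within => x; exact: cvg_cst.
Qed.

Lemma int01_derive F f : {within `[0, 1], continuous f} ->
  (forall x, 0 <= x <= 1 -> is_derive x 1 F (f x)) -> int01 f = F 1 - F 0.
Proof.
move=> cf dF; apply: Rintegral_derive => //.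
  apply: derivable_within_continuous => x; rewrite in_itv /= => /dF d.
  exact: (@ex_derive _ _ _ _ _ _ _ d).
by move=> x /andP[x0 x1]; apply: dF; rewrite !ltW.
Qed.

Lemma square_continuous_int01 (h : R -> R -> R) :
  square_continuous h -> {within `[0, 1], continuous (fun r => int01 (h r))}.
Proof.
move=> ch; apply/subspace_continuousP => r; rewrite /= in_itv /= => r01.
apply/cvgrPdist_le => e e0.
have := square_continuous_near ch r01 e0; rewrite /within /= => H.
apply: filterS H => r' hr'; rewrite in_itv /= => r'01.
rewrite distrC -int01B; [|exact: square_continuous_slice2|exact: square_continuous_slice2].
apply: int01_bound => [|s s01]; last exact: hr'.
by move=> x; apply: cvgB; exact: square_continuous_slice2.
Qed.

(** By the mean value theorem the difference quotient is [h' c s] with [c] close to [r], which is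
    uniformly close to [h' r s]. For interior [r], small increments stay in the unit interval. *)
Lemma is_derive_int01 (h h' : R -> R -> R) (r : R) : square_continuous h -> square_continuous h' ->
  (forall r s, 0 <= r <= 1 -> 0 <= s <= 1 -> is_derive r 1 (h ^~ s) (h' r s)) ->
  0 < r < 1 -> is_derive r 1 (fun r => int01 (h r)) (int01 (h' r)).
Proof.
move=> ch ch' dh r01.
have r01' : 0 <= r <= 1 by case/andP: r01 => ? ?; rewrite !ltW.
suff H : (fun k => k^-1 *: (((fun r => int01 (h r)) \o shift r) (k *: 1) - int01 (h r))) @ 0^'
    --> int01 (h' r).
  by apply: DeriveDef; [apply/cvg_ex; exists (int01 (h' r))|exact: cvg_lim].
apply/cvgrPdist_le => e e0.
have [d /= d0 dP] := square_continuous_near ch' r01' e0.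
near=> k.
have kn0 : k != 0 by near: k; exact: nbhs_dnbhs_neq.
have kd : `|k| < d by near: k; apply: dnbhs0_lt.
have kr : 0 <= k + r <= 1.
  have : `|k| < Num.min r (1 - r).
    by near: k; apply: dnbhs0_lt; rewrite lt_min; case/andP: r01 => -> ?; rewrite subr_gt0.
  rewrite lt_min !ltr_norml => /andP[/andP[? ?] /andP[? ?]]; lra.
rewrite /= /shift /= [k *: 1]mulr1.
have ck : {within `[0, 1], continuous (fun s => h (k + r) s - h r s)}.
  by move=> x; apply: cvgB; exact: square_continuous_slice2.
rewrite -[X in _ *: X]int01B; [|exact: square_continuous_slice2|exact: square_continuous_slice2].
rewrite -[_ *: _]int01Z // -int01B; [| exact: square_continuous_slice2|]; last first.
  by move=> x; apply: cvgM; [exact: cvg_cst|exact: ck].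
apply: int01_bound => [x|s s01].
  by apply: cvgB; [exact: square_continuous_slice2|apply: cvgM; [exact: cvg_cst|exact: ck]].
have [c crk ->] : exists2 c, `|r - c| < d & h (k + r) s - h r s = h' c s * k.
  have hc a b : 0 <= a -> b <= 1 -> {within `[a, b], continuous h^~ s}.
    move=> a0 b1; apply: derivable_within_continuous => x; rewrite in_itv /= => /andP[ax xb].
    have x01 : 0 <= x <= 1 by rewrite (le_trans a0) ?(le_trans xb).
    exact: (@ex_derive _ _ _ _ _ _ _ (dh _ _ x01 s01)).
  move: kn0 kd; rewrite neq_lt => /orP[k0|k0] kd.
  - have [|||c /[!in_itv] /= /andP[cl cr] E] := @MVT_segment _ (h ^~ s) (h' ^~ s) (k + r) r.
    + lra.
    + by move=> x; rewrite in_itv /= => /andP[? ?]; apply: dh => //; lra.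
    + by apply: hc; lra.
    exists c; last by rewrite -opprB E; ring.
    by move: kd; rewrite ltr0_norm // => kd; rewrite ger0_norm; lra.
  - have [|||c /[!in_itv] /= /andP[cl cr] E] := @MVT_segment _ (h ^~ s) (h' ^~ s) r (k + r).
    + lra.
    + by move=> x; rewrite in_itv /= => /andP[? ?]; apply: dh => //; lra.
    + by apply: hc; lra.
    exists c; last by rewrite E; ring.
    by move: kd; rewrite gtr0_norm // => kd; rewrite ler0_norm; lra.
have /(_ s s01) := dP c crk.
by rewrite distrC mulrCA mulVf // mulr1.
Unshelve. all: by end_near. Qed.

(** Both sides are the iterated integral of [Ar], with [s] as inner variable. Differentiation under
    the integral sign replaces an exchange of the two integrations. *)
Lemma stokes_square (A Ar B Bs C : R -> R -> R) :
  square_continuous A -> square_continuous Ar ->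
  square_continuous B -> square_continuous Bs -> square_continuous C ->
  (forall r s, 0 <= r <= 1 -> 0 <= s <= 1 -> is_derive r 1 (A ^~ s) (Ar r s)) ->
  (forall r s, 0 <= r <= 1 -> 0 <= s <= 1 -> is_derive s 1 (B r) (Bs r s)) ->
  (forall r s, 0 <= r <= 1 -> 0 <= s <= 1 -> Ar r s = Bs r s + C r s) ->
  int01 (A 1) - int01 (A 0) =
  int01 (B ^~ 1) - int01 (B ^~ 0) + int01 (fun r => int01 (C r)).
Proof.
move=> cA cAr cB cBs cC dA dB E.
have l0 : 0 <= (0 : R) <= 1 by rewrite lexx ler01.
have l1 : 0 <= (1 : R) <= 1 by rewrite lexx ler01.
have <- : int01 (fun r => int01 (Ar r)) = int01 (A 1) - int01 (A 0).
  apply: (@Rintegral_derive 0 1 (fun r => int01 (A r))) => //.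
  - exact: square_continuous_int01.
  - exact: square_continuous_int01.
  - by move=> r r01; exact: is_derive_int01.
rewrite -int01B; [|exact: square_continuous_slice1..].
rewrite -int01D; [|by move=> x; apply: cvgB; exact: square_continuous_slice1|exact: square_continuous_int01].
apply: int01_ext => r r01.
have <- : int01 (Bs r) = B r 1 - B r 0.
  by apply: int01_derive => [|s s01]; [exact: square_continuous_slice2|exact: dB].
by rewrite -int01D; [apply: int01_ext => s s01; exact: E|exact: square_continuous_slice2..].
Qed.

End Calculus.

(** * Differentiability of maps with continuous partial derivatives *)

Section Differential.
Variable R : realType.
Implicit Types (U V W : normedModType R).

Lemma continuous_fst V W : continuous (@fst V W).
Proof. by move=> x; exact: cvg_fst. Qed.

Lemma continuous_snd V W : continuous (@snd V W).
Proof. by move=> x; exact: cvg_snd. Qed.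

Lemma differentiable_fst V W x : differentiable (@fst V W) x.
Proof. by apply: linear_differentiable; exact: continuous_fst. Qed.

Lemma differentiable_snd V W x : differentiable (@snd V W) x.
Proof. by apply: linear_differentiable; exact: continuous_snd. Qed.

Lemma is_derive_fst U V W (f : U -> V * W) x v df :
  is_derive x v f df -> is_derive x v (fun y => (f y).1) df.1.
Proof.
move=> [df_ex <-].
have H : (fun h => h^-1 *: (((fun y => (f y).1) \o shift x) (h *: v) - (f x).1)) @ 0^' --> ('D_v f x).1.
  apply: (@cvg_comp _ _ _ (fun h => h^-1 *: ((f \o shift x) (h *: v) - f x)) fst _ (nbhs ('D_v f x))).
    exact: df_ex.
  exact: continuous_fst.
by apply: DeriveDef; [apply/cvg_ex; exists ('D_v f x).1|exact: cvg_lim].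
Qed.

Lemma is_derive_snd U V W (f : U -> V * W) x v df :
  is_derive x v f df -> is_derive x v (fun y => (f y).2) df.2.
Proof.
move=> [df_ex <-].
have H : (fun h => h^-1 *: (((fun y => (f y).2) \o shift x) (h *: v) - (f x).2)) @ 0^' --> ('D_v f x).2.
  apply: (@cvg_comp _ _ _ (fun h => h^-1 *: ((f \o shift x) (h *: v) - f x)) snd _ (nbhs ('D_v f x))).
    exact: df_ex.
  exact: continuous_snd.
by apply: DeriveDef; [apply/cvg_ex; exists ('D_v f x).2|exact: cvg_lim].
Qed.

Lemma derive_affine V' V W (f : V -> W) (l l' : V' -> V) x v :
  (forall h : R, l (h *: v + x) = h *: l' v + l x) ->
  (derivable (fun y => f (l y)) x v <-> derivable f (l x) (l' v)) /\
  'D_v (fun y => f (l y)) x = 'D_(l' v) f (l x).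
Proof.
move=> E; rewrite /derivable /derive.
have -> : (fun h => h^-1 *: (((fun y => f (l y)) \o shift x) (h *: v) - f (l x))) =
  (fun h => h^-1 *: ((f \o shift (l x)) (h *: l' v) - f (l x))).
  by apply/funext => h /=; rewrite E.
by [].
Qed.

Lemma is_derive_affine V' V W (f : V -> W) (l l' : V' -> V) x v df :
  (forall h : R, l (h *: v + x) = h *: l' v + l x) ->
  is_derive (l x) (l' v) f df -> is_derive x v (fun y => f (l y)) df.
Proof.
by move=> /(derive_affine f) [dE DE] [? ?]; split; [exact/dE|rewrite DE].
Qed.

Lemma differentiable_small V W (e : V -> W) x :
  (forall eps : R, 0 < eps -> \forall y \near x, `|e y - e x| <= eps * `|y - x|) ->
  differentiable e x.
Proof.
move=> He.
have H : continuous (0 : V -> W) /\ e \o shift x = cst (e x) + \0 +o_ 0 id.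
  split; first exact: cst_continuous.
  apply/eqaddoP => eps eps0 /=.
  have := He _ eps0; rewrite (near_shift 0) subr0; apply: filterS => z /=.
  by rewrite !fctE /= addr0 addrK.
apply/diff_locallyP; rewrite (_ : 'd e x = 0 :> (V -> W)) //.
by apply/diff_unique; case: H.
Qed.

Definition C1at V W (f : V -> W) x :=
  (\forall y \near x, forall v, derivable f y v) /\
  (forall v, {for x, continuous (fun y => 'D_v f y)}).

Definition C1_diff V := forall (f : V -> R) x, C1at f x -> differentiable f x.

Lemma C1_diff_line : C1_diff R.
Proof. by move=> f x [/nbhs_singleton df _]; apply/derivable1_diffP. Qed.

(* The increment in the real variable is treated by the mean value theorem, the
   one in [V] by the hypothesis; starting from [C1_diff_line] this covers all
   finite products of lines. *)
Lemma C1_diff_prod V : C1_diff V -> C1_diff (R * V)%type.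
Proof.
move=> CV f [a b] [df cf].
pose phi y := f (a, y).
have lphi (y v : V) (h : R) : (a, h *: v + y) = h *: (0, v) + (a, y) :> R * V.
  by congr (_, _); rewrite /= scaler0 add0r.
have ca : {for b, continuous (fun y : V => (a, y))}.
  by apply: continuous_pair; [exact: cvg_cst|exact: cvg_id].
have dphi : differentiable phi b.
  apply: CV; split.
    have : \forall y \near b, forall v, derivable f (a, y) v := ca _ df.
    apply: filterS => y /= dfy v.
    exact/(derive_affine f (l := fun y => (a, y)) (l' := fun v => (0, v)) (lphi y v)).1.
  move=> v; rewrite (_ : (fun y => 'D_v phi y) = (fun y => 'D_(0, v) f (a, y))).
    exact: (continuous_for_comp (g := fun z => 'D_(0, v) f z) ca (cf (0, v))).
  by apply/funext => y; have [] := derive_affine f (l := fun y => (a, y)) (l' := fun v => (0, v)) (lphi y v).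
(* [psi] linearises [f] in the real variable only and keeps the slice [phi]. The remainder [f - psi]
   then changes only through the real increment, so it has differential zero. *)
pose D1 := 'D_(1, 0) f (a, b).
pose psi (z : R * V) := D1 * z.1 + phi z.2.
have dpsi : differentiable psi (a, b).
  apply: differentiableD.
    apply: differentiableM; first exact: differentiable_cst.
    exact: differentiable_fst.
  exact: (@differentiable_comp _ _ _ _ snd phi _ (@differentiable_snd R V (a, b)) dphi).
rewrite (_ : f = psi + (fun z => f z - psi z)); last first.
  by apply/funext => z; rewrite fctE /= addrC subrK.
apply: differentiableD => //.
apply: differentiable_small => e e0.
have /cvgrPdist_le /(_ _ e0) := cf (1, 0).
move=> cfe; have [[A B] /= [nA nB] AB] := filterI df cfe.
have [d /= d0 dA] := nA.
exists (ball a d, B) => /=; first by split => //; exact: nbhsx_ballx.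
move=> [a' b'] /= [a'd Bb'].
pose c t := f (t, b').
have Hc t : ball a d t -> is_derive t 1 c ('D_(1, 0) f (t, b')) /\ `|D1 - 'D_(1, 0) f (t, b')| <= e.
  move=> /dA At; have [dt De] := AB (t, b') (conj At Bb'); split => //.
  apply: (@is_derive_affine _ _ _ f (fun t => (t, b')) (fun v => (v, 0))).
    by move=> h; congr (_, _); rewrite /= scaler0 add0r.
  exact/derivableP/dt.
have -> : f (a', b') - psi (a', b') - (f (a, b) - psi (a, b)) = c a' - c a - D1 * (a' - a).
  by rewrite /psi /phi /c /=; ring.
have [t [bt ->]] : exists t, ball a d t /\ c a' - c a = 'D_(1, 0) f (t, b') * (a' - a).
  have mvt (u v : R) : u <= v -> ball a d u -> ball a d v ->
      exists t, ball a d t /\ c v - c u = 'D_(1, 0) f (t, b') * (v - u).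
    move=> uv bu bv.
    have bb t : u <= t <= v -> ball a d t.
      move: bu bv; rewrite /ball /= !ltr_norml => /andP[? ?] /andP[? ?] /andP[? ?].
      by apply/andP; split; lra.
    have [||t tuv ->] := MVT_segment uv (f := c) (df := fun t => 'D_(1, 0) f (t, b')).
    - by move=> t /[!in_itv] /= /andP[? ?]; apply Hc, bb; rewrite !ltW.
    - apply: derivable_within_continuous => t; rewrite in_itv /= => /bb /Hc[dt _].
      exact: (@ex_derive _ _ _ _ _ _ _ dt).
    by exists t; split => //; apply: bb; rewrite in_itv /= in tuv.
  have ba : ball a d a by exact: ballxx.
  have [aa'|a'a] := leP a a'; first exact: mvt.
  have [t [bt E]] := mvt _ _ (ltW a'a) a'd ba.
  by exists t; split => //; rewrite -opprB E; ring.
have [_ De] := Hc _ bt.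
rewrite -mulrBl normrM; apply: ler_pM => //; first by rewrite distrC.
by rewrite prod_normE /= le_max lexx.
Qed.

End Differential.

(** * Symmetry of mixed partial derivatives *)

Section Smooth.
Variable R : realType.
Implicit Types (U V W : normedModType R).

Lemma near_continuous (T S : topologicalType) (f g : T -> S) x :
  (\forall y \near x, f y = g y) -> {for x, continuous f} -> {for x, continuous g}.
Proof.
move=> fg cf; rewrite /prop_for /continuous_at -(nbhs_singleton fg).
exact: cvg_trans (near_eq_cvg fg) cf.
Qed.

Lemma C1at_fst V U W (f : V -> U * W) x : C1at f x -> C1at (fun y => (f y).1) x.
Proof.
move=> [df cf]; split.
  apply: filterS df => y dy v.
  exact: (@ex_derive _ _ _ _ _ _ _ (is_derive_fst (derivableP (dy v)))).
move=> v; apply: (@near_continuous _ _ (fun y => ('D_v f y).1)).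
  apply: filterS df => y dy; apply/esym.
  exact: (@derive_val _ _ _ _ _ _ _ (is_derive_fst (derivableP (dy v)))).
exact: (continuous_for_comp (cf v) (@continuous_fst _ _ _ _)).
Qed.

Lemma C1at_snd V U W (f : V -> U * W) x : C1at f x -> C1at (fun y => (f y).2) x.
Proof.
move=> [df cf]; split.
  apply: filterS df => y dy v.
  exact: (@ex_derive _ _ _ _ _ _ _ (is_derive_snd (derivableP (dy v)))).
move=> v; apply: (@near_continuous _ _ (fun y => ('D_v f y).2)).
  apply: filterS df => y dy; apply/esym.
  exact: (@derive_val _ _ _ _ _ _ _ (is_derive_snd (derivableP (dy v)))).
exact: (continuous_for_comp (cf v) (@continuous_snd _ _ _ _)).
Qed.

Lemma smooth_near_derive V W (A : set V) (f : V -> W) v :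
  smooth_near A f -> smooth_near A (fun x => 'D_v f x).
Proof.
move=> [U [oU [AU kU]]]; exists U; split=> //; split=> // k.
by have [_ [_]] := kU k.+1; apply.
Qed.

Lemma smooth_near_C1at V W (A : set V) (f : V -> W) x :
  smooth_near A f -> A x -> C1at f x.
Proof.
move=> [U [oU [AU kU]]] Ax.
have [_ [df cf]] := kU 1%N; split.
  by apply: filterS (open_nbhs_nbhs (conj oU (AU _ Ax))) => y Uy v; exact: df.
by move=> v; apply: (cf v); rewrite inE; exact: AU.
Qed.

Lemma smooth_near_derivable V W (A : set V) (f : V -> W) x v :
  smooth_near A f -> A x -> is_derive x v f ('D_v f x).
Proof.
by move=> sf Ax; have [/nbhs_singleton df _] := smooth_near_C1at sf Ax; exact/derivableP.
Qed.

Lemma smooth_near_differentiable V (A : set V) (f : V -> R * R) x :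
  C1_diff V -> smooth_near A f -> A x -> differentiable f x.
Proof.
move=> CV sf Ax; have cf := smooth_near_C1at sf Ax.
rewrite (_ : f = fun y => ((f y).1, (f y).2)); last by apply/funext => y; case: (f y).
by apply: differentiable_pair; apply: CV; [exact: C1at_fst|exact: C1at_snd].
Qed.

(** The mean value theorem is used twice: along [u] for the difference [p] of two parallel slices of
    [f], then along [v] for [fu]. *)
Lemma second_difference V (f fu fuv : V -> R) (x u v : V) (h : R) : 0 < h ->
  (forall a b : R, 0 <= a <= h -> 0 <= b <= h ->
    is_derive (a *: u + (b *: v + x)) u f (fu (a *: u + (b *: v + x)))) ->
  (forall a b : R, 0 <= a <= h -> 0 <= b <= h ->
    is_derive (a *: u + (b *: v + x)) v fu (fuv (a *: u + (b *: v + x)))) ->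
  exists a b : R, [/\ 0 <= a <= h, 0 <= b <= h &
    f (h *: u + (h *: v + x)) - f (h *: u + x) - f (h *: v + x) + f x =
    h ^+ 2 * fuv (a *: u + (b *: v + x))].
Proof.
move=> h0 df dfu.
have hh : 0 <= h <= h by rewrite lexx ltW.
have h00 : 0 <= (0 : R) <= h by rewrite lexx ltW.
pose p (a : R) := f (a *: u + (h *: v + x)) - f (a *: u + (0 *: v + x)).
pose p' (a : R) := fu (a *: u + (h *: v + x)) - fu (a *: u + (0 *: v + x)).
have dp (a : R) : 0 <= a <= h -> is_derive a 1 p (p' a).
  move=> ah.
  have dfb (b : R) : 0 <= b <= h ->
      is_derive a 1 (fun a : R => f (a *: u + (b *: v + x))) (fu (a *: u + (b *: v + x))).
    move=> bh.
    apply: (@is_derive_affine R R V R f (fun a => a *: u + (b *: v + x)) (fun t => t *: u)).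
      by move=> t; rewrite scale1r [t *: 1]mulr1 scalerDl -addrA.
    by rewrite scale1r; exact: df.
  by apply: is_deriveB; exact: dfb.
have [||a /[!in_itv] /= ah] := MVT_segment (ltW h0) (f := p) (df := p').
- by move=> t /[!in_itv] /= /andP[? ?]; apply: dp; rewrite !ltW.
- apply: derivable_within_continuous => t; rewrite in_itv /= => /dp dt.
  exact: (@ex_derive _ _ _ _ _ _ _ dt).
pose q (b : R) := fu (a *: u + (b *: v + x)).
pose q' (b : R) := fuv (a *: u + (b *: v + x)).
have dq (b : R) : 0 <= b <= h -> is_derive b 1 q (q' b).
  move=> bh; rewrite /q /q'.
  apply: (@is_derive_affine _ _ _ _ fu (fun b : R => a *: u + (b *: v + x)) (fun t => t *: v)).
    by move=> t; rewrite scale1r [t *: 1]mulr1 scalerDl -addrA [LHS]addrCA.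
  by rewrite scale1r; exact: dfu.
have [||b /[!in_itv] /= bh] := MVT_segment (ltW h0) (f := q) (df := q').
- by move=> t /[!in_itv] /= /andP[? ?]; apply: dq; rewrite !ltW.
- apply: derivable_within_continuous => t; rewrite in_itv /= => /dq dt.
  exact: (@ex_derive _ _ _ _ _ _ _ dt).
rewrite /q /q' => Eq; rewrite /p /p' Eq !scale0r !add0r => Ep.
by exists a, b; split => //; move: Ep; rewrite !subr0 => Ep; lra.
Qed.

(* Both mixed derivatives are close to the second difference over [h ^+ 2]. *)
Lemma schwarz V (f fu fv fuv fvu : V -> R) (x u v : V) :
  (\forall y \near x, is_derive y u f (fu y) /\ is_derive y v f (fv y) /\
     is_derive y v fu (fuv y) /\ is_derive y u fv (fvu y)) ->
  {for x, continuous fuv} -> {for x, continuous fvu} -> fuv x = fvu x.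
Proof.
move=> df cuv cvu; apply/eqP; rewrite -subr_eq0 -normr_le0.
apply/ler_addgt0Pl => e e0; rewrite addr0.
have e20 : 0 < e / 2 by rewrite divr_gt0.
have Huv : \forall t \near x, `|fuv x - fuv t| <= e / 2.
  by move/cvgrPdist_le : cuv; apply.
have Hvu : \forall t \near x, `|fvu x - fvu t| <= e / 2.
  by move/cvgrPdist_le : cvu; apply.
have cl : {for (0 : R, 0 : R), continuous (fun z : R * R => z.1 *: u + (z.2 *: v + x))}.
  apply: cvgD; first by apply: cvgZr_tmp; exact: continuous_fst.
  apply: cvgD; last exact: cvg_cst.
  by apply: cvgZr_tmp; exact: continuous_snd.
move: cl; rewrite /prop_for /continuous_at /= !scale0r !add0r => /(_ _ (filterI df (filterI Huv Hvu))).
case=> -[A B] /= [[d1 /= d10 dA] [d2 /= d20 dB]] AB.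
pose h := Num.min d1 d2 / 2.
have hm : 0 < Num.min d1 d2 by rewrite lt_min d10.
have h0 : 0 < h by rewrite divr_gt0.
have hlt : h < Num.min d1 d2 by rewrite /h; lra.
move: (hlt); rewrite lt_min => /andP[h1 h2].
have P (a b : R) : 0 <= a <= h -> 0 <= b <= h -> (A `*` B) (a, b).
  move=> /andP[a0 ah] /andP[b0 bh]; split; [apply: dA|apply: dB];
  by rewrite /= sub0r normrN ger0_norm //; lra.
have [|a b ah bh|a [b [ah bh]]] := @second_difference _ f fu fuv x u v h h0.
- by move=> a b ah bh; case: (AB _ (P _ _ ah bh)) => /= -[].
- by case: (AB _ (P _ _ ah bh)) => /= -[_ [_ []]].
have [_ [/= De _]] := AB _ (P _ _ ah bh).
(* The second difference is symmetric in [u] and [v], so the same number is also [h ^+ 2] times a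
   value of [fvu]. *)
have swap a1 b1 : a1 *: v + (b1 *: u + x) = b1 *: u + (a1 *: v + x) by rewrite addrCA.
have [a1 b1 ah1 bh1|a1 b1 ah1 bh1|b' [a' [bh' ah']]] := @second_difference _ f fv fvu x v u h h0.
- by rewrite swap; case: (AB _ (P _ _ bh1 ah1)) => /= -[_ []].
- by rewrite swap; case: (AB _ (P _ _ bh1 ah1)) => /= -[_ [_ []]].
have [_ [_ /= De']] := AB _ (P _ _ ah' bh').
rewrite !swap (addrAC (f _)) => -> /(mulfI (lt0r_neq0 (exprn_gt0 2 h0))) E.
move: De De'; rewrite -E => De De'.
rewrite (_ : _ - _ = (fuv x - fvu (a' *: u + (b' *: v + x))) -
  (fvu x - fvu (a' *: u + (b' *: v + x)))); last by ring.
rewrite (le_trans (ler_normB _ _)) // [leRHS](splitr e) lerD //.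
Qed.

Lemma smooth_near_schwarz V (A : set V) (f : V -> R * R) u v x :
  smooth_near A f -> A x ->
  'D_v (fun y => 'D_u f y) x = 'D_u (fun y => 'D_v f y) x.
Proof.
move=> sf Ax.
have [df _] := smooth_near_C1at sf Ax.
have [du cu] := smooth_near_C1at (smooth_near_derive u sf) Ax.
have [dv cv] := smooth_near_C1at (smooth_near_derive v sf) Ax.
apply: injective_projections.
  apply: (@schwarz V (fun y => (f y).1) (fun y => ('D_u f y).1) (fun y => ('D_v f y).1)
    (fun y => ('D_v ('D_u f) y).1) (fun y => ('D_u ('D_v f) y).1) x u v).
  - apply: filterS (filterI df (filterI du dv)) => y [dfy [duy dvy]].
    exact: (conj (is_derive_fst (derivableP (dfy u))) (conj (is_derive_fst (derivableP (dfy v)))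
    (conj (is_derive_fst (derivableP (duy v))) (is_derive_fst (derivableP (dvy u)))))).
  - exact: (continuous_for_comp (cu v) (@continuous_fst _ _ _ _)).
  - exact: (continuous_for_comp (cv u) (@continuous_fst _ _ _ _)).
apply: (@schwarz V (fun y => (f y).2) (fun y => ('D_u f y).2) (fun y => ('D_v f y).2)
    (fun y => ('D_v ('D_u f) y).2) (fun y => ('D_u ('D_v f) y).2) x u v).
- apply: filterS (filterI df (filterI du dv)) => y [dfy [duy dvy]].
  exact: (conj (is_derive_snd (derivableP (dfy u))) (conj (is_derive_snd (derivableP (dfy v)))
    (conj (is_derive_snd (derivableP (duy v))) (is_derive_snd (derivableP (dvy u)))))).
- exact: (continuous_for_comp (cu v) (@continuous_snd _ _ _ _)).
- exact: (continuous_for_comp (cv u) (@continuous_snd _ _ _ _)).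
Qed.

End Smooth.

(** * Line integrals of 1-forms *)

Section ContinuityRules.
Variables (R : realType) (T : topologicalType).
Implicit Types (f g : T -> R) (x : T).

Lemma cont_id x : {for x, continuous (fun y : T => y)}.
Proof. exact: cvg_id. Qed.

Lemma cont_cst (S : topologicalType) (k : S) x : {for x, continuous (fun=> k)}.
Proof. exact: cvg_cst. Qed.

Lemma cont_add f g x : {for x, continuous f} -> {for x, continuous g} ->
  {for x, continuous (fun y => f y + g y)}.
Proof. by move=> cf cg; exact: cvgD. Qed.

Lemma cont_opp f x : {for x, continuous f} -> {for x, continuous (fun y => - f y)}.
Proof. by move=> cf; exact: cvgN. Qed.

Lemma cont_mul f g x : {for x, continuous f} -> {for x, continuous g} ->
  {for x, continuous (fun y => f y * g y)}.
Proof. by move=> cf cg; exact: cvgM. Qed.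

Lemma cont_sqr f x : {for x, continuous f} -> {for x, continuous (fun y => f y ^+ 2)}.
Proof. by move=> cf; exact: cont_mul. Qed.

Lemma cont_fst (S U : topologicalType) (h : T -> S * U) x :
  {for x, continuous h} -> {for x, continuous (fun y => (h y).1)}.
Proof. by move=> ch; apply: (continuous_for_comp ch); exact: cvg_fst. Qed.

Lemma cont_snd (S U : topologicalType) (h : T -> S * U) x :
  {for x, continuous h} -> {for x, continuous (fun y => (h y).2)}.
Proof. by move=> ch; apply: (continuous_for_comp ch); exact: cvg_snd. Qed.

Lemma cont_scale (V : normedModType R) f (h : T -> V) x :
  {for x, continuous f} -> {for x, continuous h} ->
  {for x, continuous (fun y => f y *: h y)}.
Proof. by move=> cf ch; exact: cvgZ. Qed.

End ContinuityRules.

(** Hypotheses are tried first, so that a composite already known to be continuous is not taken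
    apart. *)
Ltac cont := cbv beta; repeat lazymatch goal with
  | H : ?G |- ?G => exact H
  | |- {for _, continuous (fun y => @?f y + @?g y)} => apply: cont_add
  | |- {for _, continuous (fun y => - @?f y)} => apply: cont_opp
  | |- {for _, continuous (fun y => @?f y * @?g y)} => apply: cont_mul
  | |- {for _, continuous (fun y => @?f y ^+ 2)} => apply: cont_sqr
  | |- {for _, continuous (fun y => (@?f y, @?g y))} => apply: continuous_pair
  | |- {for _, continuous (fun y => @?f y *: @?g y)} => apply: cont_scale
  | |- {for _, continuous (fun y => y)} => apply: cont_id
  | |- {for _, continuous (fun y => (@?f y).1)} => apply: cont_fst
  | |- {for _, continuous (fun y => (@?f y).2)} => apply: cont_snd
  | |- {for _, continuous fst} => exact: cvg_fst
  | |- {for _, continuous snd} => exact: cvg_snd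
  | |- {for _, continuous (fun _ => _)} => apply: cont_cst
  end.

Section LineIntegrals.
Variable R : realType.
Implicit Types (p v w : R * R).

Definition cross v w : R := v.1 * w.2 - v.2 * w.1.

Lemma is_derive_comp (V W : normedModType R) (f : V -> W) (c : R -> V) (c' : V) (s : R) :
  differentiable f (c s) -> is_derive s 1 c c' ->
  is_derive s 1 (fun t => f (c t)) ('D_c' f (c s)).
Proof.
move=> df [dc <-].
have dc' : differentiable c s by exact/derivable1_diffP.
have dfc : differentiable (f \o c) s by exact: differentiable_comp.
apply: DeriveDef; first exact: diff_derivable.
by rewrite deriveE // diff_comp //= -deriveE // -deriveE.
Qed.

Lemma derive_plane (Z : normedModType R) (f : R * R -> Z) p v :
  differentiable f p -> 'D_v f p = v.1 *: 'D_(1, 0) f p + v.2 *: 'D_(0, 1) f p.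
Proof.
move=> df; rewrite !deriveE // -!linearZ -linearD; congr ('d f p _).
by case: v => a b; apply: injective_projections; rewrite /= /GRing.scale /=; ring.
Qed.

(** The partial derivatives are separate arguments so that explicit formulas, such as those of
    [dflux_form], can be supplied for them. *)
Definition C1form (eta etax etay : R * R -> R * R) :=
  forall p, disk p -> [/\ differentiable eta p, 'D_(1, 0) eta p = etax p,
    'D_(0, 1) eta p = etay p, {for p, continuous etax} & {for p, continuous etay}].

Lemma cont_form (eta : R * R -> R * R) (Phi : R -> R -> R * R) (r s : R) :
  {for (r, s), continuous (fun z : R * R => Phi z.1 z.2)} ->
  {for Phi r s, continuous eta} ->
  {for (r, s), continuous (fun z : R * R => eta (Phi z.1 z.2))}.
Proof. by move=> cP ce; exact: (continuous_for_comp cP). Qed.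

(** This is Stokes for the pullback of [eta] by [Phi]. A single [Phirs] serves for both orders of
    differentiation, so the second-order terms cancel and the curl times the Jacobian remains. *)
Lemma stokes_form eta etax etay (Phi Phir Phis Phirs : R -> R -> R * R) :
  C1form eta etax etay ->
  (forall r s : R, 0 <= r <= 1 -> 0 <= s <= 1 ->
    [/\ disk (Phi r s), is_derive r 1 (Phi ^~ s) (Phir r s),
       is_derive s 1 (Phi r) (Phis r s),
       is_derive r 1 (Phis ^~ s) (Phirs r s) & is_derive s 1 (Phir r) (Phirs r s)]) ->
  square_continuous Phi -> square_continuous Phir -> square_continuous Phis -> square_continuous Phirs ->
  int01 (fun s => pair1 eta (Phi 1 s) (Phis 1 s)) - int01 (fun s => pair1 eta (Phi 0 s) (Phis 0 s)) =
  int01 (fun r => pair1 eta (Phi r 1) (Phir r 1)) - int01 (fun r => pair1 eta (Phi r 0) (Phir r 0))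
  + int01 (fun r => int01 (fun s =>
      ((etax (Phi r s)).2 - (etay (Phi r s)).1) * cross (Phir r s) (Phis r s))).
Proof.
move=> Ceta dPhi cP cPr cPs cPrs.
pose D v p := ((v.1 * (etax p).1 + v.2 * (etay p).1), (v.1 * (etax p).2 + v.2 * (etay p).2)).
have Deta (c : R -> R * R) (c' : R * R) (t : R) : disk (c t) -> is_derive t 1 c c' ->
    is_derive t 1 (fun t => eta (c t)) (D c' (c t)).
  move=> /Ceta[de ex ey _ _] dc; have := is_derive_comp de dc.
  by rewrite derive_plane // ex ey.
have ceta (r s : R) : 0 <= r <= 1 -> 0 <= s <= 1 ->
  [/\ {for (r, s), continuous (fun z : R * R => eta (Phi z.1 z.2))},
   {for (r, s), continuous (fun z : R * R => etax (Phi z.1 z.2))} &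
   {for (r, s), continuous (fun z : R * R => etay (Phi z.1 z.2))}].
  move=> hr hs; have [dP _ _ _ _] := dPhi _ _ hr hs; have [de _ _ cx cy] := Ceta _ dP.
  have cP' := cP _ _ hr hs.
  by split; apply: (@cont_form _ Phi) => //; exact: differentiable_continuous.
apply: (@stokes_square R (fun r s => pair1 eta (Phi r s) (Phis r s))
  (fun r s => pair1 (D (Phir r s)) (Phi r s) (Phis r s) + pair1 eta (Phi r s) (Phirs r s))
  (fun r s => pair1 eta (Phi r s) (Phir r s))
  (fun r s => pair1 (D (Phis r s)) (Phi r s) (Phir r s) + pair1 eta (Phi r s) (Phirs r s))
  (fun r s => ((etax (Phi r s)).2 - (etay (Phi r s)).1) * cross (Phir r s) (Phis r s))).
1-5: by move=> r s hr hs; have [? ? ?] := ceta r s hr hs;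
     have := cPr r s hr hs; have := cPs r s hr hs; have := cPrs r s hr hs => ? ? ?;
     rewrite /pair1 /D /cross /=; cont.
- move=> r s hr hs; have [dP dr ds drs dsr] := dPhi _ _ hr hs.
  have de := Deta (Phi ^~ s) _ r dP dr.
  have e1 := is_derive_fst de; have e2 := is_derive_snd de.
  have f1 := is_derive_fst drs; have f2 := is_derive_snd drs.
  rewrite /pair1; apply: is_derive_eq => /=.
  rewrite /GRing.scale /=; ring.
- move=> r s hr hs; have [dP dr ds drs dsr] := dPhi _ _ hr hs.
  have de := Deta (Phi r) _ s dP ds.
  have e1 := is_derive_fst de; have e2 := is_derive_snd de.
  have f1 := is_derive_fst dsr; have f2 := is_derive_snd dsr.
  rewrite /pair1; apply: is_derive_eq => /=.
  rewrite /GRing.scale /=; ring.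
- by move=> r s hr hs; rewrite /pair1 /D /cross /=; ring.
Qed.

End LineIntegrals.

(** * Cones over paths and bounded end-point terms *)

Section Radial.
Variable R : realType.
Implicit Types (p v w : R * R) (c : R -> R * R).

Definition path01 c (c' : R -> R * R) := forall s : R, 0 <= s <= 1 ->
  [/\ disk (c s), is_derive s 1 c (c' s) & {for s, continuous c'}].

Lemma path01_cont c c' (s : R) : path01 c c' -> 0 <= s <= 1 -> {for s, continuous c}.
Proof.
move=> pc /pc[_ [dc _] _].
by apply: differentiable_continuous; exact/derivable1_diffP.
Qed.

Lemma lineint_path eta c c' : path01 c c' ->
  lineint eta c = int01 (fun s => pair1 eta (c s) (c' s)).
Proof. by move=> pc; apply: int01_ext => s /pc[_ [_ ->]]. Qed.

(* The primitive of [eta] given by the Poincare lemma when [eta] is closed. *)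
Definition radial (eta : R * R -> R * R) p : R := int01 (fun r => pair1 eta (r *: p) p).

Lemma radial0 eta : radial eta 0 = 0.
Proof.
rewrite /radial -[RHS](@int01_cst R 0); apply: int01_ext => r _.
by rewrite /pair1 /= !mulr0 addr0.
Qed.

Lemma disk_scale (r : R) p : 0 <= r <= 1 -> disk p -> disk (r *: p).
Proof.
move=> /andP[r0 r1]; rewrite /disk /= /GRing.scale /= => dp.
have -> : (r * p.1) ^+ 2 + (r * p.2) ^+ 2 = r ^+ 2 * (p.1 ^+ 2 + p.2 ^+ 2) by ring.
by rewrite mulr_ile1 // ?sqr_ge0 ?exprn_ile1 // addr_ge0 // sqr_ge0.
Qed.

Lemma is_derive_scalel (x : R) p : is_derive x 1 (fun r : R => r *: p) p.
Proof.
rewrite -[X in is_derive _ _ _ X]scale1r.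
apply: (@is_derive_affine _ _ _ _ id (fun r : R => r *: p) (fun r : R => r *: p)).
  by move=> h; rewrite scale1r [h *: 1]mulr1 scalerDl.
Qed.

(* Stokes on the cone [(r, s) |-> r c(s)]. *)
Lemma lineint_radial eta etax etay c c' : C1form eta etax etay -> path01 c c' ->
  lineint eta c = radial eta (c 1) - radial eta (c 0) +
   int01 (fun r => int01 (fun s =>
     ((etax (r *: c s)).2 - (etay (r *: c s)).1) * (r * cross (c s) (c' s)))).
Proof.
move=> Ceta pc.
have ccP (r s : R) : 0 <= s <= 1 -> {for (r, s), continuous (fun z : R * R => c z.2)}.
  move=> hs; apply: (@continuous_for_comp _ _ _ snd c); last exact: path01_cont pc hs.
  exact: cvg_snd.
have ccP' (r s : R) : 0 <= s <= 1 -> {for (r, s), continuous (fun z : R * R => c' z.2)}.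
  move=> /pc[_ _ cc']; apply: (@continuous_for_comp _ _ _ snd c'); last exact: cc'.
  exact: cvg_snd.
have := @stokes_form R eta etax etay (fun r s => r *: c s) (fun r s => c s)
  (fun r s => r *: c' s) (fun r s => c' s) Ceta.
rewrite (lineint_path _ pc).
have -> : int01 (fun s => pair1 eta (1 *: c s) (1 *: c' s)) = int01 (fun s => pair1 eta (c s) (c' s)).
  by apply: int01_ext => s _; rewrite !scale1r.
have -> : int01 (fun s => pair1 eta (0 *: c s) (0 *: c' s)) = 0.
  rewrite -[RHS](@int01_cst R 0); apply: int01_ext => r _.
  by rewrite /pair1 !scale0r /= !mulr0 addr0.
rewrite subr0 => ->.
- congr (_ + _); apply: int01_ext => r _; apply: int01_ext => s _.
  by rewrite /cross /= /GRing.scale /=; ring.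
- move=> r s hr hs; have [dc dcs cc] := pc _ hs; split.
  + exact: disk_scale.
  + exact: is_derive_scalel.
  + exact: (@is_deriveZ _ _ _ c r s 1 (c' s) dcs).
  + exact: is_derive_scalel.
  + exact: dcs.
- by move=> r s hr hs; have := ccP r s hs => ?; cont.
- by move=> r s hr hs; exact: ccP.
- by move=> r s hr hs; have := ccP' r s hs => ?; cont.
- by move=> r s hr hs; exact: ccP'.
Qed.

Lemma lineint_closed eta etax etay c c' : C1form eta etax etay -> path01 c c' ->
  (forall p, disk p -> (etax p).2 = (etay p).1) ->
  lineint eta c = radial eta (c 1) - radial eta (c 0).
Proof.
move=> Ceta pc cl; rewrite (lineint_radial Ceta pc) -[RHS]addr0; congr (_ + _).
rewrite -[RHS](@int01_cst R 0); apply: int01_ext => r hr.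
rewrite -[RHS](@int01_cst R 0); apply: int01_ext => s hs.
have [dc _ _] := pc _ hs.
by rewrite cl ?subrr ?mul0r //; exact: disk_scale.
Qed.

Lemma path01_cross_within c c' : path01 c c' ->
  {within `[0, 1], continuous (fun s => cross (c s) (c' s))}.
Proof.
move=> pc; apply: continuous_for_within => s; rewrite /= in_itv /= => hs.
have [_ _ ?] := pc _ hs; have ? := path01_cont pc hs; rewrite /cross.
by cont.
Qed.

Lemma lineint_primitive eta etax etay c c' : C1form eta etax etay -> path01 c c' ->
  (forall p, disk p -> (etax p).2 - (etay p).1 = 1) ->
  lineint eta c = radial eta (c 1) - radial eta (c 0) + int01 (fun s => cross (c s) (c' s)) / 2.
Proof.
move=> Ceta pc cl; rewrite (lineint_radial Ceta pc); congr (_ + _).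
set E := int01 (fun s => cross (c s) (c' s)).
(* With curl 1 the cone contributes [E] times int_0^1 r dr = 1/2. *)
rewrite [LHS](_ : _ = int01 (fun r => E * r)).
  rewrite int01Z; last by apply: continuous_for_within => x _; exact: cvg_id.
  congr (_ * _).
  transitivity (1 ^+ 2 / 2 - 0 ^+ 2 / 2 : R); last by rewrite expr1n expr0n /= mul0r subr0 mul1r.
  apply: (@int01_derive _ (fun x : R => x ^+ 2 / 2)).
    by apply: continuous_for_within => x _; exact: cvg_id.
  by move=> x _; apply: is_derive_eq; rewrite /GRing.scale /=; field.
apply: int01_ext => r hr; rewrite mulrC -int01Z; last exact: path01_cross_within.
apply: int01_ext => s hs; have [dc _ _] := pc _ hs.
by rewrite cl ?mul1r //; exact: disk_scale.
Qed.

Lemma primitive_C1form eta : primitive_omega eta ->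
  C1form eta (fun p => 'D_(1, 0) eta p) (fun p => 'D_(0, 1) eta p).
Proof.
move=> [se _] p dp; have [_ ce] := smooth_near_C1at se dp.
split => //; apply: smooth_near_differentiable se dp.
exact/C1_diff_prod/C1_diff_line.
Qed.

Lemma disk_compact : compact (@disk R).
Proof.
apply: (@subclosed_compact _ _ ((`[-1, 1]%classic : set R) `*` (`[-1, 1]%classic : set R))).
- have -> : @disk R = (fun p : R * R => p.1 ^+ 2 + p.2 ^+ 2) @^-1` [set x | x <= 1] by [].
  apply: preimage_closed; last exact: closed_le.
  move=> p _; change {for p, continuous (fun p : R * R => p.1 ^+ 2 + p.2 ^+ 2)}.
  by cont.
- by apply: compact_setX; exact: segment_compact.
- move=> [x y]; rewrite /disk /= => h; split; rewrite /= in_itv /= -ler_norml.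
    by rewrite -(@ler_pXn2r _ 2) ?nnegrE // expr1n -normrX ger0_norm ?sqr_ge0 //; nra.
  by rewrite -(@ler_pXn2r _ 2) ?nnegrE // expr1n -normrX ger0_norm ?sqr_ge0 //; nra.
Qed.

(** This controls the end-point terms of all iterates at once. The bound is twice a bound of [eta]
    on the compact disk, one for each coordinate of the pairing. *)
Lemma radial_bounded (eta : R * R -> R * R) : (forall p, disk p -> {for p, continuous eta}) ->
  exists C : R, forall p, disk p -> `|radial eta p| <= C.
Proof.
move=> ce.
have [M [_ MP]] : bounded_set (eta @` disk).
  apply/compact_bounded/continuous_compact; last exact: disk_compact.
  by apply: continuous_in_subspaceT => p; rewrite inE; exact: ce.
pose C := Num.max 0 M + 1.
have C0 : 0 <= C by rewrite addr_ge0 // le_max lexx.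
have CP p : disk p -> `|eta p| <= C.
  by move=> dp; apply: MP; [rewrite ltr_pwDr // le_max lexx orbT|exists p].
have normx (x y : R) : x ^+ 2 + y ^+ 2 <= 1 -> `|x| <= 1.
  by move=> h; rewrite ler_norml; nra.
exists (C + C) => p dp; apply: int01_bound.
  apply: continuous_for_within => r; rewrite /= in_itv /= => hr.
  have cr : {for r, continuous (fun r : R => eta (r *: p))}.
    apply: (@continuous_for_comp _ _ _ (fun r : R => r *: p)); first by cont.
    exact/ce/disk_scale.
  by rewrite /pair1; cont.
move=> r hr; have := CP _ (disk_scale hr dp); rewrite prod_normE ge_max => /andP[h1 h2].
rewrite (le_trans (ler_normD _ _)) // lerD // normrM -[leRHS]mulr1 ler_pM //.
  exact: normx dp.
by apply: (@normx _ p.1); rewrite addrC.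
Qed.

End Radial.

(** * The flux form of a symplectic isotopy *)

Section DerivativeRules.
Variable R : realType.

(** Nothing is known of [f] outside the unit interval, so the derivative is computed as a one-sided
    limit: from the right if t < 1, from the left at t = 1. *)
Lemma is_derive_constant (V : normedModType R) (f : R -> V) (t : R) (df k : V) : 0 <= t <= 1 ->
  (forall s, 0 <= s <= 1 -> f s = k) -> is_derive t 1 f df -> df = 0.
Proof.
move=> t01 fk [dex <-]; have [t1|t1] := ltP t 1.
  rewrite /derive cvg_at_rightE //; apply/cvg_lim => //.
  apply: (@cvg_trans _ (cst 0 @ at_right (0 : R))); last exact: cvg_cst.
  apply: near_eq_cvg; near=> h => /=.
  rewrite !fk ?subrr ?scaler0 // [h *: 1]mulr1.
  have : 0 < h by near: h; exact: nbhs_right_gt.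
  have : h < 1 - t by near: h; apply: nbhs_right_lt; rewrite subr_gt0.
  by move=> ? ?; move/andP: t01 => [? ?]; apply/andP; split; lra.
rewrite /derive cvg_at_leftE //; apply/cvg_lim => //.
apply: (@cvg_trans _ (cst 0 @ at_left (0 : R))); last exact: cvg_cst.
apply: near_eq_cvg; near=> h => /=.
rewrite !fk ?subrr ?scaler0 // [h *: 1]mulr1.
have : h < 0 by near: h; exact: nbhs_left_lt.
have : - 1 < h by near: h; apply: nbhs_left_gt; rewrite oppr_lt0.
by move=> ? ?; move/andP: t01 => [? ?]; apply/andP; split; lra.
Unshelve. all: by end_near. Qed.

Lemma is_derive_cross (V : normedModType R) (a b : V -> R * R) x v (a' b' : R * R) :
  is_derive x v a a' -> is_derive x v b b' ->
  is_derive x v (fun y => cross (a y) (b y)) (cross a' (b x) + cross (a x) b').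
Proof.
move=> da db.
have := is_derive_fst da; have := is_derive_snd da.
have := is_derive_fst db; have := is_derive_snd db => ? ? ? ?.
by rewrite /cross; apply: is_derive_eq; rewrite /GRing.scale /=; ring.
Qed.

Lemma differentiable_cross (V : normedModType R) (a b : V -> R * R) x :
  differentiable a x -> differentiable b x -> differentiable (fun y => cross (a y) (b y)) x.
Proof.
move=> da db.
have d1 (c : V -> R * R) : differentiable c x -> differentiable (fun y => (c y).1) x.
  by move=> dc; apply: (@differentiable_comp _ _ _ _ c fst) => //; exact: differentiable_fst.
have d2 (c : V -> R * R) : differentiable c x -> differentiable (fun y => (c y).2) x.
  by move=> dc; apply: (@differentiable_comp _ _ _ _ c snd) => //; exact: differentiable_snd.
by apply: differentiableB; apply: differentiableM; [exact: d1|exact: d2|exact: d2|exact: d1].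
Qed.

Lemma cont_cross (T : topologicalType) (a b : T -> R * R) x :
  {for x, continuous a} -> {for x, continuous b} ->
  {for x, continuous (fun y => cross (a y) (b y))}.
Proof. by move=> ? ?; rewrite /cross; cont. Qed.

Lemma cont_dot (T : topologicalType) (a b : T -> R * R) x :
  {for x, continuous a} -> {for x, continuous b} ->
  {for x, continuous (fun y => (a y).1 * (b y).1 + (a y).2 * (b y).2)}.
Proof. by move=> ? ?; cont. Qed.

Lemma cont_lincomb (T : topologicalType) (v a b : T -> R * R) x :
  {for x, continuous v} -> {for x, continuous a} -> {for x, continuous b} ->
  {for x, continuous (fun y => (v y).1 *: a y + (v y).2 *: b y)}.
Proof.
move=> cv ca cb.
by apply: cvgD; apply: cvgZ => //; [exact: cont_fst|exact: cont_snd].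
Qed.

Lemma crossC (v w : R * R) : cross v w = - cross w v.
Proof. by rewrite /cross; ring. Qed.

Lemma cross_linear (a v b c : R * R) :
  cross a (v.1 *: b + v.2 *: c) = pair1 (fun=> (cross a b, cross a c)) 0 v.
Proof. by rewrite /pair1 /cross /= /GRing.scale /=; ring. Qed.

(** The algebra behind closedness of [flux_form]. Here [x], [y], [t] stand for the first partials of
    the isotopy and a second letter for a further derivative; the last hypothesis is the vanishing
    time derivative of [cross x y]. *)
Lemma cross_exchange (xt tx yt ty x y t yx xy : R * R) :
  xt = tx -> yt = ty -> yx = xy -> cross xt y + cross x yt = 0 ->
  cross tx y + cross t yx = cross ty x + cross t xy.
Proof.
move=> -> -> -> H; congr (_ + _); rewrite [RHS]crossC.
by apply/eqP; rewrite -addr_eq0 H.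
Qed.

End DerivativeRules.

Section Slices.
Variables (R : realType) (f : R * (R * R) -> R * R).
Hypothesis sf : smooth_near (unit_interval `*` disk) f.

Lemma domP (t : R) (p : R * R) : 0 <= t <= 1 -> disk p -> (unit_interval `*` disk) (t, p).
Proof. by move=> t01 dp; split => //=; rewrite /unit_interval /= in_itv. Qed.

Lemma iso_differentiable (t : R) (p : R * R) : 0 <= t <= 1 -> disk p -> differentiable f (t, p).
Proof.
move=> t01 dp; apply: smooth_near_differentiable sf (domP t01 dp).
exact/C1_diff_prod/C1_diff_prod/C1_diff_line.
Qed.

Lemma iso_continuous (t : R) (p : R * R) : 0 <= t <= 1 -> disk p -> {for (t, p), continuous f}.
Proof. by move=> t01 dp; apply: differentiable_continuous; exact: iso_differentiable. Qed.

Lemma slice_continuous (t : R) (p : R * R) : 0 <= t <= 1 -> disk p ->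
  {for p, continuous (fun q => f (t, q))}.
Proof.
move=> t01 dp; apply: (@continuous_for_comp _ _ _ (fun q => (t, q)) f); first by cont.
exact: iso_continuous.
Qed.

Lemma slice_differentiable (t : R) (p : R * R) : 0 <= t <= 1 -> disk p ->
  differentiable (fun q => f (t, q)) p.
Proof.
move=> t01 dp; apply: (@differentiable_comp _ _ _ _ (fun q => (t, q)) f).
  by apply: differentiable_pair; [exact: differentiable_cst|].
exact: iso_differentiable.
Qed.

Lemma slice_derive (t : R) (p v : R * R) : 'D_v (fun q => f (t, q)) p = 'D_(0, v) f (t, p).
Proof.
apply: (@derive_affine _ _ _ _ f (fun q => (t, q)) (fun v => (0, v)) _ _ _).2 => h.
by congr (_, _); rewrite /= scaler0 add0r.
Qed.

Lemma is_derive_slice (t : R) (p v : R * R) : 0 <= t <= 1 -> disk p ->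
  is_derive p v (fun q => f (t, q)) ('D_(0, v) f (t, p)).
Proof.
move=> t01 dp; rewrite -slice_derive; apply/derivableP/diff_derivable.
exact: slice_differentiable.
Qed.

Lemma is_derive_time (t : R) (p : R * R) : 0 <= t <= 1 -> disk p ->
  is_derive t 1 (fun t => f (t, p)) ('D_(1, 0) f (t, p)).
Proof.
move=> t01 dp; apply: (@is_derive_affine _ _ _ _ f (fun t => (t, p)) (fun h => (h, 0))).
  by move=> h; congr (_, _); rewrite /= scaler0 add0r.
exact: smooth_near_derivable sf (domP t01 dp).
Qed.

Lemma is_derive_space (t : R) (c : R -> R * R) (c' : R * R) (s : R) : 0 <= t <= 1 -> disk (c s) ->
  is_derive s 1 c c' ->
  is_derive s 1 (fun s => f (t, c s))
    (c'.1 *: 'D_(0, (1, 0)) f (t, c s) + c'.2 *: 'D_(0, (0, 1)) f (t, c s)).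
Proof.
move=> t01 dc dcs; have := is_derive_comp (slice_differentiable t01 dc) dcs.
by rewrite (derive_plane _ (slice_differentiable t01 dc)) !slice_derive.
Qed.

End Slices.

Section Flux.
Variables (R : realType) (g ginv : R -> R * R -> R * R).
Hypothesis Hsmooth : smooth_near (unit_interval `*` disk) (fun z : R * (R * R) => g z.1 z.2).
Hypothesis Hsymp : forall t, unit_interval t -> sympD (g t) (ginv t).

(* [iso_t], [iso_x], [iso_y] are the partial derivatives of [(t, p) |-> g_t(p)];
   they are sealed because deciding whether two of them are convertible unfolds
   the real numbers [0] and [1] in their direction vectors. *)
Fact iso_t_key : {f | f = fun z => 'D_(1, 0) (fun z : R * (R * R) => g z.1 z.2) z}.
Proof. by eexists. Qed.
Definition iso_t := sval iso_t_key.
Fact iso_x_key : {f | f = fun z => 'D_(0, (1, 0)) (fun z : R * (R * R) => g z.1 z.2) z}.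
Proof. by eexists. Qed.
Definition iso_x := sval iso_x_key.
Fact iso_y_key : {f | f = fun z => 'D_(0, (0, 1)) (fun z : R * (R * R) => g z.1 z.2) z}.
Proof. by eexists. Qed.
Definition iso_y := sval iso_y_key.

Lemma iso_tE : iso_t = fun z => 'D_(1, 0) (fun z : R * (R * R) => g z.1 z.2) z.
Proof. exact: svalP iso_t_key. Qed.

Lemma smooth_iso_t : smooth_near (unit_interval `*` disk) iso_t.
Proof. by rewrite iso_tE; exact: smooth_near_derive. Qed.

Lemma iso_xE : iso_x = fun z => 'D_(0, (1, 0)) (fun z : R * (R * R) => g z.1 z.2) z.
Proof. exact: svalP iso_x_key. Qed.

Lemma smooth_iso_x : smooth_near (unit_interval `*` disk) iso_x.
Proof. by rewrite iso_xE; exact: smooth_near_derive. Qed.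

Lemma iso_yE : iso_y = fun z => 'D_(0, (0, 1)) (fun z : R * (R * R) => g z.1 z.2) z.
Proof. exact: svalP iso_y_key. Qed.

Lemma smooth_iso_y : smooth_near (unit_interval `*` disk) iso_y.
Proof. by rewrite iso_yE; exact: smooth_near_derive. Qed.

Lemma iso_schwarz_x (t : R) (p : R * R) : 0 <= t <= 1 -> disk p ->
  'D_(1, 0) iso_x (t, p) = 'D_(0, (1, 0)) iso_t (t, p).
Proof.
by move=> t01 dp; rewrite iso_xE iso_tE; exact: smooth_near_schwarz Hsmooth (domP t01 dp).
Qed.

Lemma iso_schwarz_y (t : R) (p : R * R) : 0 <= t <= 1 -> disk p ->
  'D_(1, 0) iso_y (t, p) = 'D_(0, (0, 1)) iso_t (t, p).
Proof.
by move=> t01 dp; rewrite iso_yE iso_tE; exact: smooth_near_schwarz Hsmooth (domP t01 dp).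
Qed.

(** Writing the result with time derivatives of [iso_x] and [iso_y] gives the same mixed derivative
    as differentiating the pushed velocity in time, as [stokes_form] demands. *)
Lemma is_derive_iso_t_space (t : R) (c : R -> R * R) (c' : R * R) (s : R) :
  0 <= t <= 1 -> disk (c s) -> is_derive s 1 c c' ->
  is_derive s 1 (fun s => iso_t (t, c s))
    (c'.1 *: 'D_(1, 0) iso_x (t, c s) + c'.2 *: 'D_(1, 0) iso_y (t, c s)).
Proof.
move=> t01 dc dcs.
have E (u u' v v' : R * R) : u = u' -> v = v' ->
  is_derive s 1 (fun s => iso_t (t, c s)) (c'.1 *: u' + c'.2 *: v') ->
  is_derive s 1 (fun s => iso_t (t, c s)) (c'.1 *: u + c'.2 *: v) by move=> -> ->.
exact: (E _ _ _ _ (iso_schwarz_x t01 dc) (iso_schwarz_y t01 dc)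
  (is_derive_space smooth_iso_t t01 dc dcs)).
Qed.

Lemma sympD_iso (t : R) : 0 <= t <= 1 -> sympD (g t) (ginv t).
Proof. by move=> t01; apply: Hsymp; rewrite /unit_interval /= in_itv. Qed.

Lemma jac_iso (t : R) (p : R * R) : 0 <= t <= 1 -> disk p -> cross (iso_x (t, p)) (iso_y (t, p)) = 1.
Proof.
move=> t01 dp; have [_ [_ [_ [_ [_ [_ /(_ _ dp)]]]]]] := sympD_iso t01.
rewrite /jac.
have E v : 'D_v (g t) p = 'D_(0, v) (fun z : R * (R * R) => g z.1 z.2) (t, p).
  exact: (slice_derive (fun z : R * (R * R) => g z.1 z.2) t p v).
by rewrite !E => <-; rewrite /cross iso_xE iso_yE; congr (_ - _); rewrite mulrC.
Qed.

(* [g_t^* (i_{X_t} omega) = omega (dg_t/dt, Dg_t -)], as [X_t = dg_t/dt o g_t^-1]. *)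
Definition flux_form (t : R) (p : R * R) :=
  (cross (iso_t (t, p)) (iso_x (t, p)), cross (iso_t (t, p)) (iso_y (t, p))).

Definition dflux_form (v : R * R) (t : R) (p : R * R) :=
  (cross ('D_(0, v) iso_t (t, p)) (iso_x (t, p)) + cross (iso_t (t, p)) ('D_(0, v) iso_x (t, p)),
   cross ('D_(0, v) iso_t (t, p)) (iso_y (t, p)) + cross (iso_t (t, p)) ('D_(0, v) iso_y (t, p))).

Lemma flux_formP (t : R) : 0 <= t <= 1 ->
  C1form (flux_form t) (dflux_form (1, 0) t) (dflux_form (0, 1) t).
Proof.
move=> t01 p dp.
have dt := slice_differentiable smooth_iso_t t01 dp.
have dx := slice_differentiable smooth_iso_x t01 dp.
have dy := slice_differentiable smooth_iso_y t01 dp.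
have D v : is_derive p v (flux_form t) (dflux_form v t p).
  have et : is_derive p v (fun q => iso_t (t, q)) ('D_(0, v) iso_t (t, p)).
    exact: (is_derive_slice smooth_iso_t).
  have ex : is_derive p v (fun q => iso_x (t, q)) ('D_(0, v) iso_x (t, p)).
    exact: (is_derive_slice smooth_iso_x).
  have ey : is_derive p v (fun q => iso_y (t, q)) ('D_(0, v) iso_y (t, p)).
    exact: (is_derive_slice smooth_iso_y).
  have d1 := is_derive_cross et ex.
  have d2 := is_derive_cross et ey.
  have df : differentiable (flux_form t) p.
    exact: (differentiable_pair (differentiable_cross dt dx) (differentiable_cross dt dy)).
  split; first exact: diff_derivable.
  have D := derivableP (diff_derivable (v := v) df).
  apply: injective_projections.
  - have := is_derive_fst D => -[_ <-]; by case: d1.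
  - have := is_derive_snd D => -[_ <-]; by case: d2.
have C v : {for p, continuous (dflux_form v t)}.
  have ct := slice_continuous smooth_iso_t t01 dp.
  have cx := slice_continuous smooth_iso_x t01 dp.
  have cy := slice_continuous smooth_iso_y t01 dp.
  have ct' := slice_continuous (smooth_near_derive (0, v) smooth_iso_t) t01 dp.
  have cx' := slice_continuous (smooth_near_derive (0, v) smooth_iso_x) t01 dp.
  have cy' := slice_continuous (smooth_near_derive (0, v) smooth_iso_y) t01 dp.
  exact: (continuous_pair
    (cont_add (cont_cross ct' cx) (cont_cross ct cx'))
    (cont_add (cont_cross ct' cy) (cont_cross ct cy'))).
split.
- exact: (differentiable_pair (differentiable_cross dt dx) (differentiable_cross dt dy)).
- by case: (D (1, 0)).
- by case: (D (0, 1)).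
- exact: (C (1, 0)).
- exact: (C (0, 1)).
Qed.

(* The exterior derivative of [flux_form] is the time derivative of [det Dg_t]. *)
Lemma flux_form_closed (t : R) (p : R * R) : 0 <= t <= 1 -> disk p ->
  (dflux_form (1, 0) t p).2 = (dflux_form (0, 1) t p).1.
Proof.
move=> t01 dp; have ap := domP t01 dp.
have ex := is_derive_time smooth_iso_x t01 dp.
have ey := is_derive_time smooth_iso_y t01 dp.
have /is_derive_constant := is_derive_cross ex ey.
move=> /(_ 1 t01 (fun s s01 => jac_iso s01 dp)).
have Sxy : 'D_(0, (1, 0)) iso_y (t, p) = 'D_(0, (0, 1)) iso_x (t, p).
  by rewrite iso_xE iso_yE; exact: smooth_near_schwarz Hsmooth ap.
exact: cross_exchange (iso_schwarz_x t01 dp) (iso_schwarz_y t01 dp) Sxy.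
Qed.

Lemma pair1_flux_form (t : R) (p v : R * R) :
  pair1 (flux_form t) p v = cross (iso_t (t, p)) (v.1 *: iso_x (t, p) + v.2 *: iso_y (t, p)).
Proof. by rewrite cross_linear. Qed.

Lemma iso_push_path (t : R) (c c' : R -> R * R) : 0 <= t <= 1 -> path01 c c' ->
  path01 (fun s => g t (c s))
    (fun s => (c' s).1 *: iso_x (t, c s) + (c' s).2 *: iso_y (t, c s)).
Proof.
move=> t01 pc s s01; have [dc dcs cc] := pc _ s01; split.
- by have [_ [_ [gd _]]] := sympD_iso t01; exact: gd.
- by rewrite iso_xE iso_yE; exact: (is_derive_space Hsmooth t01 dc dcs).
- have cc0 := path01_cont pc s01.
  have h1 : {for s, continuous (fun s => iso_x (t, c s))}.
    apply: (@continuous_for_comp _ _ _ c (fun q => iso_x (t, q)) s cc0).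
    exact: (slice_continuous smooth_iso_x).
  have h2 : {for s, continuous (fun s => iso_y (t, c s))}.
    apply: (@continuous_for_comp _ _ _ c (fun q => iso_y (t, q)) s cc0).
    exact: (slice_continuous smooth_iso_y).
  exact: cont_lincomb.
Qed.

End Flux.

(** * Tangent vectors and arcs of the unit circle *)

Section CirclePaths.
Variable R : realType.

Lemma circleP (p : R * R) : circle p -> exists th : R, p = (cos th, sin th).
Proof.
case: p => x y; rewrite /circle /= => xy.
have x1 : -1 <= x <= 1 by apply/andP; split; nra.
have sx : sin (acos x) = `|y|.
  by rewrite sin_acos // -sqrtr_sqr; congr Num.sqrt; rewrite -xy; ring.
have [y0|y0] := leP 0 y.
  by exists (acos x); rewrite acosK ?in_itv // sx ger0_norm.
by exists (- acos x); rewrite cosN sinN acosK ?in_itv // sx ltr0_norm // opprK.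
Qed.

Lemma circle_cos_sin (th : R) : circle (cos th, sin th).
Proof. exact: cos2Dsin2. Qed.

Lemma circle_disk (p : R * R) : circle p -> disk p.
Proof. by rewrite /circle /disk /= => ->. Qed.

Lemma disk0 : disk (0 : R * R).
Proof. by rewrite /disk /= expr0n /= addr0 ler01. Qed.

(** Needed because [g 0] and [g t \o ginv t] are the identity only on the disk, so along a path they
    are controlled only for parameters in the unit interval. *)
Lemma is_derive_eq_on (V : normedModType R) (f h : R -> V) (t : R) (df dh : V) : 0 <= t <= 1 ->
  (forall s : R, 0 <= s <= 1 -> f s = h s) ->
  is_derive t 1 f df -> is_derive t 1 h dh -> df = dh.
Proof.
move=> t01 fh Df Dh; apply/subr0_eq.
apply: (@is_derive_constant _ _ (fun s => f s - h s) t _ 0 t01).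
by move=> s s01; rewrite fh // subrr.
Qed.

Lemma is_derive_sqnorm (h : R -> R * R) (h' : R * R) (t : R) : is_derive t 1 h h' ->
  is_derive t 1 (fun s => (h s).1 ^+ 2 + (h s).2 ^+ 2) (((h t).1 * h'.1 + (h t).2 * h'.2) *+ 2).
Proof.
move=> dh; have := is_derive_fst dh; have := is_derive_snd dh => ? ?.
by apply: is_derive_eq; rewrite /GRing.scale /=; ring.
Qed.

Lemma circle_orthogonal (h : R -> R * R) (h' : R * R) (t : R) : 0 <= t <= 1 ->
  (forall s : R, 0 <= s <= 1 -> circle (h s)) -> is_derive t 1 h h' ->
  (h t).1 * h'.1 + (h t).2 * h'.2 = 0.
Proof.
move=> t01 ch /is_derive_sqnorm/is_derive_constant H.
by have /eqP := H _ t01 ch; rewrite mulrn_eq0 => /eqP.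
Qed.

(** Vectors orthogonal to the same unit vector of the plane are parallel. *)
Lemma cross_tangent (p v w : R * R) : circle p ->
  p.1 * v.1 + p.2 * v.2 = 0 -> p.1 * w.1 + p.2 * w.2 = 0 -> cross v w = 0.
Proof.
rewrite /circle /= => cp pv pw.
rewrite -[LHS]mul1r -cp.
transitivity ((p.1 * v.1 + p.2 * v.2) * cross p w - (p.1 * w.1 + p.2 * w.2) * cross p v).
  by rewrite /cross; ring.
by rewrite pv pw !mul0r subrr.
Qed.

Definition arc (a b s : R) : R * R := (cos (a + s * (b - a)), sin (a + s * (b - a))).
Definition arc' (a b s : R) : R * R :=
  (- sin (a + s * (b - a)) * (b - a), cos (a + s * (b - a)) * (b - a)).

Lemma is_derive_pair (V W : normedModType R) (f : R -> V) (h : R -> W) (df : V) (dh : W) (t : R) :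
  is_derive t 1 f df -> is_derive t 1 h dh -> is_derive t 1 (fun s => (f s, h s)) (df, dh).
Proof.
move=> [/derivable1_diffP df1 ef] [/derivable1_diffP dh1 eh].
have dfh : differentiable (fun s => (f s, h s)) t by exact: differentiable_pair.
have D := derivableP (diff_derivable (v := (1 : R)) dfh).
split; first exact: diff_derivable.
apply: injective_projections.
- by have [_ /= <-] := is_derive_fst D.
- by have [_ /= <-] := is_derive_snd D.
Qed.

Lemma arc1 (a b : R) : arc a b 1 = (cos b, sin b).
Proof. by rewrite /arc mul1r [a + _]addrC subrK. Qed.

Lemma arc0 (a b : R) : arc a b 0 = (cos a, sin a).
Proof. by rewrite /arc mul0r addr0. Qed.

Lemma arc_path (a b : R) : path01 (arc a b) (arc' a b).
Proof.
move=> s s01; split; first exact/circle_disk/circle_cos_sin.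
- have dl : is_derive s 1 (fun s : R => a + s * (b - a)) (b - a).
    by apply: is_derive_eq; rewrite /GRing.scale /=; ring.
  exact: is_derive_pair (is_derive1_comp (is_derive_cos _) dl) (is_derive1_comp (is_derive_sin _) dl).
- have cl : {for s, continuous (fun s : R => a + s * (b - a))} by cont.
  have cs : {for s, continuous (fun s : R => sin (a + s * (b - a)))}.
    by apply: (continuous_for_comp cl); exact: continuous_sin.
  have cc : {for s, continuous (fun s : R => cos (a + s * (b - a)))}.
    by apply: (continuous_for_comp cl); exact: continuous_cos.
  by rewrite /arc'; cont.
Qed.

End CirclePaths.

(** * Flux from the origin to the boundary, and change of area *)

Section FluxOfIsotopy.
Variables (R : realType) (g ginv : R -> R * R -> R * R).
Hypothesis Hsmooth : smooth_near (unit_interval `*` disk) (fun z : R * (R * R) => g z.1 z.2).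
Hypothesis Hsymp : forall t, unit_interval t -> sympD (g t) (ginv t).
Hypothesis Hfix : forall t, unit_interval t -> g t origin = origin.
Hypothesis Hid : forall p, disk p -> g 0 p = p.
Hypothesis Hcirc : forall (t : R) p, 0 <= t <= 1 -> circle p -> circle (g t p).

Local Notation it := (iso_t g).
Local Notation ix := (iso_x g).
Local Notation iy := (iso_y g).
Local Notation flux := (flux_form g).

Let push (t : R) (c c' : R -> R * R) (s : R) :=
  (c' s).1 *: ix (t, c s) + (c' s).2 *: iy (t, c s).

Let I0 : 0 <= (0 : R) <= 1. Proof. by rewrite lexx ler01. Qed.

Lemma iso_fix (t : R) : 0 <= t <= 1 -> g t 0 = 0.
Proof. by move=> t01; apply: Hfix; rewrite /unit_interval /= in_itv. Qed.

Lemma is_derive_iso_t (t : R) (p : R * R) : 0 <= t <= 1 -> disk p ->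
  is_derive t 1 (fun t => g t p) (it (t, p)).
Proof. by rewrite iso_tE; exact: (is_derive_time Hsmooth). Qed.

(** The difference is the integral of the closed flux form along an arc. Its integrand pairs the
    velocity of an orbit with that of the image of the arc; both are tangent to the circle at the
    same point. *)
Lemma radial_flux_circle (t a b : R) : 0 <= t <= 1 ->
  radial (flux t) (cos a, sin a) = radial (flux t) (cos b, sin b).
Proof.
move=> t01; apply/esym/eqP; rewrite -subr_eq0; apply/eqP.
have := lineint_closed (flux_formP Hsmooth t01) (arc_path a b)
  (fun p dp => flux_form_closed Hsmooth Hsymp t01 dp).
rewrite arc1 arc0 => <-.
rewrite (lineint_path _ (arc_path a b)) -[RHS](@int01_cst R 0); apply: int01_ext => s s01.
rewrite pair1_flux_form.
have carc r : circle (arc a b r) by exact: circle_cos_sin.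
have [_ dpush _] := iso_push_path Hsmooth Hsymp t01 (arc_path a b) s01.
apply: (@cross_tangent _ (g t (arc a b s))); first exact: Hcirc.
  apply: (@circle_orthogonal _ (fun r => g r (arc a b s)) _ t t01).
    by move=> r r01; exact: Hcirc.
  exact/is_derive_iso_t/circle_disk.
apply: (@circle_orthogonal _ (fun r => g t (arc a b r)) _ s s01) => //.
by move=> r r01; exact: Hcirc.
Qed.

Lemma radial_flux_const (t : R) (p q : R * R) : 0 <= t <= 1 -> circle p -> circle q ->
  radial (flux t) p = radial (flux t) q.
Proof.
by move=> t01 /circleP[a ->] /circleP[b ->]; exact: radial_flux_circle.
Qed.

Lemma lineint_flux (t : R) (c c' : R -> R * R) : 0 <= t <= 1 -> path01 c c' -> c 0 = 0 ->
  lineint (flux t) c = radial (flux t) (c 1).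
Proof.
move=> t01 pc c0.
rewrite (lineint_closed (flux_formP Hsmooth t01) pc (fun p dp => flux_form_closed Hsmooth Hsymp t01 dp)).
by rewrite c0 radial0 subr0.
Qed.

(* The 1-form [- y dx + x dy]. *)
Let rot90 (p : R * R) := (- p.2, p.1).

(** The curl is 1 - (- 1) = 2, which is the origin of the factor 2 in [area_change]. *)
Lemma rot90P : C1form rot90 (fun=> (0, 1)) (fun=> (- 1, 0)).
Proof.
move=> p _.
have D (v : R * R) : is_derive p v rot90 (- v.2, v.1).
  have dr : differentiable rot90 p.
    apply: differentiable_pair; last exact: differentiable_fst.
    exact/differentiableN/differentiable_snd.
  split; first exact: diff_derivable.
  have D := derivableP (diff_derivable (v := v) dr).
  have D1 := is_derive_fst (is_derive_id p v); have D2 := is_derive_snd (is_derive_id p v).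
  apply: injective_projections.
  - have [_ <-] := is_derive_fst D.
    by have [_ <-] := is_deriveN (f := fun q : R * R => q.2) D2.
  - by have [_ <-] := is_derive_snd D; case: D1.
split; try exact: cont_cst.
- apply: differentiable_pair; last exact: differentiable_fst.
  exact/differentiableN/differentiable_snd.
- by have [_ ->] := D (1, 0); rewrite /= oppr0.
- by have [_ ->] := D (0, 1).
Qed.

(* Stokes on the square [(t, s) |-> g_t(c(s))]. *)
Lemma area_change (c c' : R -> R * R) : path01 c c' -> c 0 = 0 -> circle (c 1) ->
  int01 (fun s => cross (g 1 (c s)) (push 1 c c' s)) - int01 (fun s => cross (c s) (c' s)) =
  int01 (fun t => cross (g t (c 1)) (it (t, c 1))) +
  int01 (fun t => 2 * radial (flux t) (c 1)).
Proof.
move=> pc c0 c1.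
have ccont (s : R) : 0 <= s <= 1 -> {for s, continuous c}.
  by move=> s01; exact: path01_cont pc s01.
have pcf (f : R * (R * R) -> R * R) : smooth_near (unit_interval `*` disk) f ->
    square_continuous (fun r s => f (r, c s)).
  move=> sf r s r01 s01.
  apply: (@continuous_for_comp _ _ _ (fun z : R * R => (z.1, c z.2)) f).
    apply: continuous_pair; first by cont.
    by apply: (@continuous_for_comp _ _ _ snd c); [exact: cvg_snd|exact: ccont].
  by apply: iso_continuous => //; have [] := pc _ s01.
have pcc : square_continuous (fun r s => c' s).
  move=> r s r01 s01; apply: (@continuous_for_comp _ _ _ snd c'); first exact: cvg_snd.
  by have [] := pc _ s01.
have pcl (f h : R * (R * R) -> R * R) : smooth_near (unit_interval `*` disk) f ->
    smooth_near (unit_interval `*` disk) h ->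
    square_continuous (fun r s => (c' s).1 *: f (r, c s) + (c' s).2 *: h (r, c s)).
  move=> sf sh r s r01 s01.
  have hf := pcf _ sf _ _ r01 s01; have hh := pcf _ sh _ _ r01 s01.
  have hc := pcc _ _ r01 s01.
  exact: (cont_lincomb hc hf hh).
have sx := smooth_iso_x Hsmooth; have sy := smooth_iso_y Hsmooth.
have st := smooth_iso_t Hsmooth.
have := @stokes_form R rot90 _ _ (fun r s => g r (c s)) (fun r s => it (r, c s))
  (fun r s => push r c c' s)
  (fun r s => (c' s).1 *: 'D_(1, 0) ix (r, c s) + (c' s).2 *: 'D_(1, 0) iy (r, c s)) rot90P.
have pr (p v : R * R) : pair1 rot90 p v = cross p v.
  by rewrite /pair1 /rot90 /cross /=; ring.
rewrite (_ : int01 (fun s => pair1 _ (g 1 _) _) = int01 (fun s => cross (g 1 (c s)) (push 1 c c' s))); last first.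
  by apply: int01_ext => s _.
(* At time 0 the isotopy is the identity on the disk, so the pushed velocity is that of [c]. *)
rewrite (_ : int01 (fun s => pair1 _ (g 0 _) _) = int01 (fun s => cross (c s) (c' s))); last first.
  apply: int01_ext => s s01; rewrite pr.
  have [dc dcs _] := pc _ s01; rewrite Hid //; congr (cross _ _).
  have [_ dpush _] := iso_push_path Hsmooth Hsymp I0 pc s01.
  apply: is_derive_eq_on s01 _ dpush dcs => r r01.
  by rewrite Hid //; have [] := pc _ r01.
(* This edge stays at the origin, where [rot90] vanishes. *)
rewrite (_ : int01 (fun r => pair1 _ (g r (c 0)) _) = 0); last first.
  rewrite -[RHS](@int01_cst R 0); apply: int01_ext => r r01.
  by rewrite pr c0 iso_fix // /cross /= !mul0r subrr.
rewrite subr0 => ->.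
- congr (_ + _).
    by apply: int01_ext => t t01; rewrite pr.
  apply: int01_ext => t t01; rewrite -(lineint_flux t01 pc c0).
  rewrite (lineint_path _ pc) -int01Z.
    by apply: int01_ext => s s01; rewrite pair1_flux_form /= opprK.
  apply: continuous_for_within => s; rewrite /= in_itv /= => s01.
  have [dc _ hc] := pc _ s01; have hc0 := ccont _ s01.
  have hf : {for s, continuous (fun s => flux t (c s))}.
    apply: (continuous_for_comp hc0); apply: differentiable_continuous.
    by have [] := flux_formP Hsmooth t01 dc.
  exact: (cont_dot hf hc).
- move=> r s r01 s01; have [dc dcs _] := pc _ s01; split.
  + by have [_ [_ [gd _]]] := sympD_iso Hsymp r01; exact: gd.
  + exact: is_derive_iso_t.
  + by have [_ dpush _] := iso_push_path Hsmooth Hsymp r01 pc s01.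
  + apply: is_deriveD; apply: (@is_deriveZ).
      exact: (is_derive_time sx).
    exact: (is_derive_time sy).
  + exact: (is_derive_iso_t_space Hsmooth r01 dc dcs).
- exact: (pcf _ Hsmooth).
- exact: (pcf _ st).
- exact: (pcl _ _ sx sy).
- move=> r s r01 s01.
  exact: (pcl (fun z => 'D_(1, 0) ix z) (fun z => 'D_(1, 0) iy z)
    (smooth_near_derive _ sx) (smooth_near_derive _ sy) r s r01 s01).
Qed.

End FluxOfIsotopy.

(** * Angle functions and translation numbers *)

Section AngleLift.
Variable R : realType.
Notation mu := (@lebesgue_measure R).

(* Near [t], [phi s = phi t + asin (sin (phi s - phi t))], and this sine is
   [cross (w t) (w s)]. *)
Lemma is_derive_angle (w : R -> R * R) (w' : R * R) (phi : R -> R) (t : R) :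
  {for t, continuous phi} ->
  (\forall s \near t, w s = (cos (phi s), sin (phi s))) -> is_derive t 1 w w' ->
  is_derive t 1 phi (cross (w t) w').
Proof.
move=> cphi wphi dw.
pose h s := cross (w t) (w s).
have dh : is_derive t 1 h (cross (w t) w').
  apply: (is_derive_eq (is_derive_cross (is_derive_cst (w t) t 1) dw)).
  by rewrite /cross /= !mul0r subrr add0r.
have ht : h t = 0 by rewrite /h /cross mulrC subrr.
have da : is_derive (h t) 1 asin 1.
  have := @is_derive1_asin R (h t); rewrite ht expr0n /= subr0 sqrtr1 invr1; apply.
  by apply/andP; split; lra.
have dp : is_derive t 1 (fun s => phi t + asin (h s)) (cross (w t) w').
  apply: (is_derive_eq (is_deriveD (is_derive_cst (phi t) t 1) (is_derive1_comp da dh))).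
  by rewrite add0r mul1r.
apply: near_eq_is_derive dp.
(* Continuity of [phi] keeps the increment in the range where [asin] inverts [sin]. *)
have pi2 : 0 < pi / 2 :> R by rewrite divr_gt0 // pi_gt0.
have near_phi : \forall s \near t, `|phi t - phi s| < pi / 2.
  by move/cvgrPdist_lt : cphi; apply.
have wt := nbhs_singleton wphi.
apply: filterS2 near_phi wphi => s hs ws.
rewrite /h wt ws /cross /=.
rewrite (_ : _ - _ = sin (phi s - phi t)); last by rewrite sinB; ring.
rewrite sinK; first by ring.
by rewrite in_itv /=; move: hs; rewrite ltr_norml => /andP[? ?]; apply/andP; split; lra.
Qed.

(** The angle [phi] is merely continuous; inside the interval it inherits differentiability from
    [w]. A general [T] is kept because the lift is studied at every time. *)
Lemma angle_increment (w w' : R -> R * R) (phi : R -> R) (T : R) : 0 < T <= 1 ->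
  {within `[0, T], continuous phi} ->
  (forall t : R, 0 <= t <= 1 -> w t = (cos (phi t), sin (phi t))) ->
  (forall t : R, 0 <= t <= 1 -> is_derive t 1 w (w' t)) ->
  (forall t : R, 0 <= t <= 1 -> {for t, continuous w'}) ->
  \int[mu]_(t in `[0, T]) cross (w t) (w' t) = phi T - phi 0.
Proof.
move=> /andP[T0 T1] cphi wphi dw cw'.
apply: Rintegral_derive => //.
  apply: continuous_for_within => t; rewrite /= in_itv /= => /andP[t0 tT].
  have t01 : 0 <= t <= 1 by rewrite t0 (le_trans tT).
  apply: cont_cross; last exact: cw'.
  by apply: differentiable_continuous; apply/derivable1_diffP; case: (dw _ t01).
move=> t /andP[t0 tT].
have t01 : 0 <= t <= 1 by rewrite (ltW t0) (le_trans (ltW tT)).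
have [cp _ _] := (continuous_within_itvP phi T0).1 cphi.
apply: is_derive_angle; last exact: dw.
  by apply: cp; rewrite in_itv /= t0.
near=> s; apply: wphi; apply/andP; split.
  by apply: ltW; near: s; exact: lt_nbhsr.
apply: ltW; apply: lt_le_trans T1; near: s; exact: lt_nbhsl.
Unshelve. all: by end_near. Qed.

End AngleLift.

Section TranslationNumber.
Variable R : realType.

(** The arbitrary codomain allows its use both for the displacement of a lift and for the point
    [(cos x, sin x)]. *)
Lemma periodic_reduce (S : Type) (d : R -> S) (T : R) : 0 < T -> (forall x, d (x + T) = d x) ->
  forall x, exists2 y, 0 <= y <= T & d y = d x.
Proof.
move=> T0 dT.
have dn n x : d (x + T *+ n) = d x.
  by elim: n => [|n IH]; rewrite ?addr0 // mulrSr addrA dT.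
have dz (k : int) x : d (x + T *~ k) = d x.
  by case: k => n; [exact: dn|rewrite NegzE mulrNz -[LHS](dn n.+1) subrK].
move=> x; exists (x + T *~ (- Num.floor (x / T))); last exact: dz.
have /andP[h1 h2] := floor_itv (x / T).
rewrite mulrNz -mulrzr; move: h1 h2; rewrite ler_pdivlMr // ltr_pdivrMr // intrD => h1 h2.
apply/andP; split; first by rewrite subr_ge0 mulrC.
by move: h2; rewrite mulrDl mul1r => h2; rewrite lerBlDr; rewrite mulrC in h2; lra.
Qed.

(* Compare [a m / m] and [a n / n] with [a (m * n) / (m * n)]. *)
Lemma quasi_additive_cvg (a : nat -> R) (C : R) : a 0%N = 0 ->
  (forall m n, `|a (m + n)%N - a m - a n| <= C) -> cvgn (fun n => a n / n%:R).
Proof.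
move=> a0 aD.
have C0 : 0 <= C by apply: le_trans (aD 0%N 0%N).
have aM m n : `|a (m * n)%N - m%:R * a n| <= m%:R * C.
  elim: m => [|m IH]; first by rewrite !mul0n a0 !mul0r subrr normr0.
  rewrite mulSn.
  rewrite (_ : _ - _ = (a (n + m * n)%N - a n - a (m * n)%N) + (a (m * n)%N - m%:R * a n)); last first.
    by rewrite -natr1; ring.
  rewrite (le_trans (ler_normD _ _)) // -natr1 mulrDl mul1r addrC lerD //.
have aq m n : (0 < m)%N -> (0 < n)%N -> `|a (m * n)%N / (m * n)%:R - a n / n%:R| <= C / n%:R.
  move=> m0 n0.
  have m0' : 0 < m%:R :> R by rewrite ltr0n.
  have n0' : 0 < n%:R :> R by rewrite ltr0n.
  rewrite (_ : _ - _ = (a (m * n)%N - m%:R * a n) / (m%:R * n%:R)); last first.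
    by rewrite natrM; field; rewrite !gt_eqF.
  rewrite normrM normfV (ger0_norm (mulr_ge0 (ltW m0') (ltW n0'))).
  rewrite ler_pdivrMr ?mulr_gt0 // (le_trans (aM m n)) // le_eqVlt; apply/orP; left.
  by apply/eqP; field; rewrite gt_eqF.
apply: R_complete; apply: cauchy_exP => e e0.
(* Each of the two comparisons through the product index costs at most [C / N%:R]. *)
have [N N0 NC] : exists2 N : nat, (0 < N)%N & (C + C) / N%:R < e.
  exists (Num.truncn ((C + C) / e)).+1 => //.
  rewrite ltr_pdivrMr ?ltr0n // mulrC -ltr_pdivrMr //.
  exact: truncnS_gt.
exists (a N / N%:R); exists N => // n /= Nn.
have n0 : (0 < n)%N by exact: leq_trans N0 Nn.
rewrite /ball /=; apply: le_lt_trans NC.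
rewrite (_ : _ - _ = (a (N * n)%N / (N * n)%:R - a n / n%:R) - (a (n * N)%N / (n * N)%:R - a N / N%:R)); last first.
  by rewrite (mulnC n N); ring.
rewrite (le_trans (ler_normB _ _)) // mulrDl lerD //; last exact: aq.
rewrite (le_trans (aq _ _ _ _)) // ler_wpM2l // lef_pV2 ?posrE ?ltr0n // ler_nat //.
Qed.

Lemma bounded_over_nat (b : nat -> R) (K : R) : (forall n, `|b n| <= K) ->
  (fun n => b n / n%:R) @ \oo --> (0 : R).
Proof.
move=> bK; have K0 : 0 <= K by apply: le_trans (bK 0%N).
apply/cvgrPdist_le => e e0.
exists (Num.truncn (K / e)).+1 => // n /= Nn.
have n0 : 0 < n%:R :> R by rewrite ltr0n (leq_trans _ Nn).
rewrite sub0r normrN normrM normfV (ger0_norm (ltW n0)) ler_pdivrMr //.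
rewrite (le_trans (bK n)) // mulrC -ler_pdivrMr // (le_trans (ltW (truncnS_gt _))) // ler_nat //.
Qed.

(** The displacement of the iterate is [T]-periodic, so [x] may be taken between 0 and [T]; there
    monotonicity confines the iterate to one period above [iter n f 0]. *)
Lemma iter_degree1 (f : R -> R) (T : R) : 0 < T -> {homo f : x y / x <= y} ->
  (forall x, f (x + T) = f x + T) ->
  forall n x, `|iter n f x - x - iter n f 0| <= T.
Proof.
move=> T0 mf fT n.
have mfn : {homo iter n f : x y / x <= y}.
  by elim: n => // n IH x y xy /=; exact/mf/IH.
have fnT x : iter n f (x + T) = iter n f x + T.
  by elim: n {mfn} => //= n ->.
move=> x.
have [|y /andP[y0 yT] <-] := periodic_reduce (d := fun x => iter n f x - x - iter n f 0) T0 _ x.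
  by move=> z; rewrite fnT; ring.
have := fnT 0; rewrite add0r => fT0.
have := mfn _ _ y0; have := mfn _ _ yT; rewrite fT0 => h1 h2.
by rewrite ler_norml; apply/andP; split; lra.
Qed.

(** [iter_degree1] at the point [iter n f 0] says that the orbit of 0 is additive up to [T]. *)
Lemma translation_cvg (f : R -> R) (T : R) : 0 < T -> {homo f : x y / x <= y} ->
  (forall x, f (x + T) = f x + T) -> cvgn (fun n => iter n f 0 / n%:R).
Proof.
move=> T0 mf fT; apply: (quasi_additive_cvg (C := T)) => // m n.
by rewrite iterD addrAC; exact: iter_degree1.
Qed.

End TranslationNumber.

(** * The boundary lift and iteration *)

Section BoundaryLift.
Variables (R : realType) (g ginv : R -> R * R -> R * R).
Hypothesis Hsmooth : smooth_near (unit_interval `*` disk) (fun z : R * (R * R) => g z.1 z.2).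
Hypothesis Hsymp : forall t, unit_interval t -> sympD (g t) (ginv t).
Variable F : R -> R -> R.
Hypothesis HFc : {within unit_interval `*` setT, continuous (fun z : R * R => F z.1 z.2)}.
Hypothesis HF0 : forall th, F 0 th = th.
Hypothesis HFlift : forall t th, unit_interval t ->
     g t (cos th, sin th) = (cos (F t th), sin (F t th)).

Lemma unit_intervalE (t : R) : unit_interval t <-> 0 <= t <= 1.
Proof. by rewrite /unit_interval /= in_itv. Qed.

Lemma iso_circle (t : R) (p : R * R) : 0 <= t <= 1 -> circle p -> circle (g t p).
Proof.
move=> /unit_intervalE t01 /circleP[th ->]; rewrite HFlift //; exact: circle_cos_sin.
Qed.

Lemma lift_cont_time (T th : R) : T <= 1 -> {within `[0, T], continuous (F ^~ th)}.
Proof.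
move=> T1; apply/subspace_continuousP => t; rewrite /= in_itv /= => /andP[t0 tT].
have At : (unit_interval `*` setT) (t, th).
  by split => //=; apply/unit_intervalE; rewrite t0 (le_trans tT).
have H := (subspace_continuousP _ _).1 HFc (t, th) At.
move=> P /H; rewrite /= !nbhs_simpl /within /= => HP.
have ci : {for t, continuous (fun s : R => (s, th))} by cont.
have := ci _ HP; rewrite /= nbhs_simpl /=; apply: filterS => s /= Ps sT; apply: Ps; split => //=.
by apply/unit_intervalE; move: sT; rewrite in_itv /= => /andP[-> sT]; exact: le_trans T1.
Qed.

Lemma lift_cont_space (t : R) : 0 <= t <= 1 -> continuous (F t).
Proof.
move=> t01 th.
have At : (unit_interval `*` setT) (t, th) by split => //=; apply/unit_intervalE.
have H := (subspace_continuousP _ _).1 HFc (t, th) At.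
move=> P /H; rewrite /= !nbhs_simpl /within /= => HP.
have ci : {for th, continuous (fun s : R => (t, s))} by cont.
have := ci _ HP; rewrite /= nbhs_simpl /=; apply: filterS => s /= Ps; apply: Ps; split => //=.
Qed.

Lemma iso_t_cont (p : R * R) (t : R) : disk p -> 0 <= t <= 1 ->
  {for t, continuous (fun t => iso_t g (t, p))}.
Proof.
move=> dp t01; apply: (@continuous_for_comp _ _ _ (fun t => (t, p)) (iso_t g)); first by cont.
exact: (iso_continuous (smooth_iso_t Hsmooth)).
Qed.

Lemma lift_increment (T th : R) : 0 < T <= 1 ->
  \int[lebesgue_measure]_(t in `[0, T]) cross (g t (cos th, sin th)) (iso_t g (t, (cos th, sin th)))
  = F T th - th.
Proof.
move=> T01; rewrite -[X in _ - X]HF0.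
have dth : disk (cos th, sin th) by exact/circle_disk/circle_cos_sin.
apply: (@angle_increment R (fun t => g t (cos th, sin th))
  (fun t => iso_t g (t, (cos th, sin th))) (F ^~ th)) => //.
- by apply: lift_cont_time; case/andP: T01.
- by move=> t t01; apply: HFlift; exact/unit_intervalE.
- by move=> t t01; exact: (is_derive_iso_t Hsmooth).
- by move=> t t01; exact: iso_t_cont.
Qed.

(* By [lift_increment] both sides only depend on the boundary point. *)
Lemma lift_equivariant (t a b : R) : 0 <= t <= 1 -> (cos a, sin a) = (cos b, sin b) :> R * R ->
  F t a - a = F t b - b.
Proof.
move=> /andP[]; rewrite le_eqVlt => /orP[/eqP <- _ _|t0 t1 E]; first by rewrite !HF0 !subrr.
have t01 : 0 < t <= 1 by rewrite t0.
by rewrite -!(lift_increment _ t01) E.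
Qed.

Lemma lift_degree1 (t th : R) : 0 <= t <= 1 -> F t (th + pi *+ 2) = F t th + pi *+ 2.
Proof.
move=> t01; have := @lift_equivariant t (th + pi *+ 2) th t01.
by rewrite sinD2pi cosD2pi => /(_ erefl) E; lra.
Qed.

(* [g_t] maps the circle onto itself: by the intermediate value theorem [F t]
   takes all values in an interval of length [2 pi]. *)
Lemma ginv_circle (t : R) (p : R * R) : 0 <= t <= 1 -> circle p -> circle (ginv t p).
Proof.
move=> t01 cp.
have [_ [_ [_ [_ [gK _]]]]] := Hsymp ((unit_intervalE t).2 t01).
pose h0 := F t 0.
(* [al] is the angle of [p] rotated by [- h0], so that [h0 + al] is an angle of [p] lying between
   [F t 0] and [F t (pi *+ 2)]. *)
have [al /andP[al0 al1] [E1 E2]] : exists2 al : R, 0 <= al <= pi *+ 2 &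
    (cos al, sin al) = (p.1 * cos h0 + p.2 * sin h0, p.2 * cos h0 - p.1 * sin h0).
  have [|al ->] := @circleP R (p.1 * cos h0 + p.2 * sin h0, p.2 * cos h0 - p.1 * sin h0).
    move: cp; rewrite /circle /= => cp.
    transitivity ((p.1 ^+ 2 + p.2 ^+ 2) * (cos h0 ^+ 2 + sin h0 ^+ 2)); first by ring.
    by rewrite cp cos2Dsin2 mulr1.
  have pi20 : 0 < pi *+ 2 :> R by rewrite pmulrn_lgt0 // pi_gt0.
  apply: (periodic_reduce (d := fun x : R => (cos x, sin x)) pi20) => x.
  by rewrite cosD2pi sinD2pi.
have [|||y _ Fy] := @IVT R (F t) 0 (pi *+ 2) (h0 + al).
- by rewrite mulrn_wge0 // pi_ge0.
- by apply: continuous_subspaceT; exact: lift_cont_space.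
- rewrite -[pi *+ 2]add0r lift_degree1 // -/h0 ge_min le_max.
  by apply/andP; split; apply/orP; [left|right]; lra.
have -> : p = g t (cos y, sin y).
  rewrite HFlift; last exact/unit_intervalE.
  rewrite Fy cosD sinD E1 E2; have := cos2Dsin2 h0.
  case: p {cp E1 E2} => x z /= h; apply: injective_projections => /=.
    transitivity (x * (cos h0 ^+ 2 + sin h0 ^+ 2)); last by ring.
    by rewrite h mulr1.
  transitivity (z * (cos h0 ^+ 2 + sin h0 ^+ 2)); last by ring.
  by rewrite h mulr1.
by rewrite gK; [exact: circle_cos_sin|exact/circle_disk/circle_cos_sin].
Qed.

(** Equal lifted angles give equal boundary points, as [g 1] is injective on the disk; then the
    displacements agree, and so do the angles. *)
Lemma lift_injective : injective (F 1).
Proof.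
have I1 : 0 <= (1 : R) <= 1 by rewrite lexx ler01.
have [_ [_ [_ [_ [gK _]]]]] := Hsymp ((unit_intervalE 1).2 I1).
move=> a b Fab.
have gab : g 1 (cos a, sin a) = g 1 (cos b, sin b).
  by rewrite !HFlift ?Fab //; exact/unit_intervalE.
have dcs (x : R) : disk (cos x, sin x) by exact/circle_disk/circle_cos_sin.
have := congr1 (ginv 1) gab; rewrite !gK // => /(lift_equivariant I1).
by rewrite Fab => /addrI /oppr_inj.
Qed.

(** A continuous injection of the line is strictly monotone, and degree one excludes the decreasing
    case. *)
Lemma lift_homo : {homo F 1 : x y / x <= y}.
Proof.
have I1 : 0 <= (1 : R) <= 1 by rewrite lexx ler01.
have pi20 : 0 < pi *+ 2 :> R by rewrite pmulrn_lgt0 // pi_gt0.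
have := @itv_continuous_inj_mono R (F 1) `]-oo, +oo[.
case.
- by apply: continuous_subspaceT; exact: lift_cont_space.
- by move=> x y _ _; exact: lift_injective.
- move=> m x y; rewrite le_eqVlt => /orP[/eqP -> //|xy].
  by apply: ltW; rewrite m ?in_itv.
move=> m; exfalso.
have := m (pi *+ 2) 0; rewrite !in_itv /= => /(_ isT isT).
rewrite -[in F 1 (pi *+ 2)](add0r (pi *+ 2)) lift_degree1 // => H.
have : F 1 0 < F 1 0 + pi *+ 2 by rewrite ltrDl.
by move=> /lt_trans /(_ (H pi20)); rewrite ltxx.
Qed.

End BoundaryLift.

Section PathsFromSmoothMaps.
Variable R : realType.

Lemma smooth_path (c : R -> R * R) : smooth_near unit_interval c ->
  (forall s, unit_interval s -> disk (c s)) -> path01 c (fun s => 'D_1 c s).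
Proof.
move=> sc dc s s01.
have us : unit_interval s by rewrite /unit_interval /= in_itv.
split; first exact: dc.
- exact: smooth_near_derivable sc us.
- by have [_ cc] := smooth_near_C1at sc us; exact: cc.
Qed.

(** Meant for [ginv t], whose smoothness is given for each fixed [t] and not jointly in time. *)
Lemma map_path (f : R * R -> R * R) (c c' : R -> R * R) : smooth_near disk f ->
  (forall p, disk p -> disk (f p)) -> path01 c c' ->
  path01 (fun s => f (c s))
    (fun s => (c' s).1 *: 'D_(1, 0) f (c s) + (c' s).2 *: 'D_(0, 1) f (c s)).
Proof.
move=> sf df pc s s01; have [dc dcs cc] := pc _ s01.
have dfc : differentiable f (c s).
  by apply: smooth_near_differentiable sf dc; exact/C1_diff_prod/C1_diff_line.
split; first exact: df.
- have := is_derive_comp dfc dcs; rewrite derive_plane //.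
- have cc0 := path01_cont pc s01; have [_ cD] := smooth_near_C1at sf dc.
  have h1 := continuous_for_comp cc0 (cD (1, 0)).
  have h2 := continuous_for_comp cc0 (cD (0, 1)).
  exact: (cont_lincomb cc h1 h2).
Qed.

End PathsFromSmoothMaps.

(** * Flux along the pulled-back path and area of the iterated paths *)

Section Assembly.
Variables (R : realType) (g ginv : R -> R * R -> R * R).
Hypothesis Hsmooth : smooth_near (unit_interval `*` disk) (fun z : R * (R * R) => g z.1 z.2).
Hypothesis Hsymp : forall t, unit_interval t -> sympD (g t) (ginv t).
Hypothesis Hfix : forall t, unit_interval t -> g t origin = origin.
Hypothesis Hid : forall p, disk p -> g 0 p = p.
Variable F : R -> R -> R.
Hypothesis HFc : {within unit_interval `*` setT, continuous (fun z : R * R => F z.1 z.2)}.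
Hypothesis HF0 : forall th, F 0 th = th.
Hypothesis HFlift : forall t th, unit_interval t ->
     g t (cos th, sin th) = (cos (F t th), sin (F t th)).
Variable gamma : R -> R * R.
Hypothesis Hgam : smooth_near unit_interval gamma.
Hypothesis HgamD : forall s, unit_interval s -> disk (gamma s).
Hypothesis Hgam0 : gamma 0 = origin.
Hypothesis Hgam1 : circle (gamma 1).

Let I1 : 0 <= (1 : R) <= 1. Proof. by rewrite lexx ler01. Qed.
Let Hcirc (t : R) p : 0 <= t <= 1 -> circle p -> circle (g t p).
Proof. exact: (iso_circle HFlift). Qed.

(** Along u = g_t^-1 gamma one has X_t(gamma) = (dg_t/dt)(u) and gamma' = Dg_t u', so the integrand
    is the flux form evaluated on u'. *)
Lemma S_inner (t : R) (p : R * R) : 0 <= t <= 1 -> circle p ->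
  int01 (fun s =>
    (vfield g ginv t (gamma s)).1 * ('D_1 gamma s).2
    - (vfield g ginv t (gamma s)).2 * ('D_1 gamma s).1) = radial (flux_form g t) p.
Proof.
move=> t01 cp.
have [_ [si [_ [gi [gK [giK _]]]]]] := Hsymp ((unit_intervalE t).2 t01).
have pg := smooth_path Hgam HgamD.
have pu := map_path si gi pg.
set u' := (X in path01 _ X) in pu.
have u0 : ginv t (gamma 0) = 0.
  by rewrite Hgam0 -[in LHS](Hfix ((unit_intervalE t).2 t01)) gK //; exact: disk0.
have pgu := iso_push_path Hsmooth Hsymp t01 pu.
(* The end point of the pulled-back path moves with [t] but stays on the circle, where the radial
   primitive is constant. *)
rewrite (radial_flux_const Hsmooth Hsymp Hcirc t01 cp
  (ginv_circle Hsmooth Hsymp HFc HF0 HFlift t01 Hgam1)).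
rewrite -(lineint_flux Hsmooth Hsymp t01 pu u0) (lineint_path _ pu).
apply: int01_ext => s s01; rewrite pair1_flux_form.
have [du _ _] := pu _ s01; have [dg dgs _] := pg _ s01; have [_ dgu _] := pgu _ s01.
have -> : vfield g ginv t (gamma s) = iso_t g (t, ginv t (gamma s)).
  by have [_ <-] := is_derive_iso_t Hsmooth t01 du.
suff <- : 'D_1 gamma s = (u' s).1 *: iso_x g (t, ginv t (gamma s)) +
                (u' s).2 *: iso_y g (t, ginv t (gamma s)) by [].
apply: is_derive_eq_on s01 _ dgs dgu => r r01.
by rewrite giK //; have [] := pg _ r01.
Qed.

Lemma S_path_radial (p : R * R) : circle p ->
  S_path gamma g ginv = int01 (fun t => radial (flux_form g t) p).
Proof. by move=> cp; apply: int01_ext => t t01; exact: S_inner. Qed.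

Lemma radial_flux_within (p : R * R) : disk p ->
  {within `[0, 1], continuous (fun t => radial (flux_form g t) p)}.
Proof.
move=> dp; apply: (@square_continuous_int01 R (fun t r => pair1 (flux_form g t) (r *: p) p)).
move=> t r t01 r01.
have cf (f : R * (R * R) -> R * R) : smooth_near (unit_interval `*` disk) f ->
    {for (t, r), continuous (fun z : R * R => f (z.1, z.2 *: p))}.
  move=> sf; apply: (@continuous_for_comp _ _ _ (fun z : R * R => (z.1, z.2 *: p)) f).
    by cont.
  by apply: iso_continuous => //; exact: disk_scale.
have ct := cf _ (smooth_iso_t Hsmooth).
have cx := cf _ (smooth_iso_x Hsmooth).
have cy := cf _ (smooth_iso_y Hsmooth).
have h : {for (t, r), continuous (fun z : R * R => flux_form g z.1 (z.2 *: p))}.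
  exact: (continuous_pair (cont_cross ct cx) (cont_cross ct cy)).
have cp : {for (t, r), continuous (fun _ : R * R => p)} by exact: cont_cst.
exact: (cont_dot h cp).
Qed.

Fixpoint iter_path (n : nat) : R -> R * R :=
  if n is n.+1 then fun s => g 1 (iter_path n s) else gamma.

Lemma iter_pathE n : iter n (g 1) \o gamma = iter_path n.
Proof. by elim: n => // n /= <-. Qed.

(** The velocity is given by the chain rule in exactly the form in which [area_change] at time 1
    returns it. *)
Fixpoint iter_path' (n : nat) : R -> R * R :=
  if n is n.+1 then fun s =>
    (iter_path' n s).1 *: iso_x g (1, iter_path n s) +
    (iter_path' n s).2 *: iso_y g (1, iter_path n s)
  else fun s => 'D_1 gamma s.

Lemma iter_pathP n : path01 (iter_path n) (iter_path' n).
Proof.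
elim: n => [|n IH]; first exact: smooth_path.
exact: (iso_push_path Hsmooth Hsymp I1 IH).
Qed.

Lemma iter_path0 n : iter_path n 0 = 0.
Proof.
elim: n => [|n IH] //=; rewrite IH.
by apply: Hfix; exact/unit_intervalE.
Qed.

Lemma iter_path1 n (th : R) : gamma 1 = (cos th, sin th) ->
  iter_path n 1 = (cos (iter n (F 1) th), sin (iter n (F 1) th)).
Proof.
move=> gth; elim: n => [|n IH] //=; rewrite IH HFlift //; exact/unit_intervalE.
Qed.

(** Each step adds the displacement of [F 1] at the current angle and twice the flux. The flux does
    not depend on the boundary point, so it equals [S_path] every time. *)
Lemma area_iter n (th : R) : gamma 1 = (cos th, sin th) ->
  int01 (fun s => cross (iter_path n s) (iter_path' n s)) =
  int01 (fun s => cross (gamma s) ('D_1 gamma s)) +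
  (iter n (F 1) th - th) + n%:R * (2 * S_path gamma g ginv).
Proof.
move=> gth; elim: n => [|n IH]; first by rewrite /= subrr mul0r !addr0.
have c1 : circle (iter_path n 1) by rewrite (iter_path1 n gth); exact: circle_cos_sin.
have := area_change Hsmooth Hsymp Hfix Hid (iter_pathP n) (iter_path0 n) c1.
rewrite -[X in X - _ = _]/(int01 (fun s => cross (iter_path n.+1 s) (iter_path' n.+1 s))).
rewrite int01Z; last exact/radial_flux_within/circle_disk.
rewrite -(S_path_radial c1) (iter_path1 n gth).
have T01 : 0 < (1 : R) <= 1 by rewrite lexx ltr01.
have : int01 (fun t => cross (g t (cos (iter n (F 1) th), sin (iter n (F 1) th)))
    (iso_t g (t, (cos (iter n (F 1) th), sin (iter n (F 1) th))))) = _ :=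
  lift_increment Hsmooth HFc HF0 HFlift (iter n (F 1) th) T01.
move=> ->.
by rewrite IH -natr1 -iterS => E; lra.
Qed.

Lemma sigma_iter (eta : R * R -> R * R) n (th : R) : primitive_omega eta ->
  gamma 1 = (cos th, sin th) ->
  sigma eta gamma (iter n (g 1)) = n%:R * S_path gamma g ginv + (iter n (F 1) th - th) / 2 +
    (radial eta (iter_path n 1) - radial eta (gamma 1)).
Proof.
move=> He gth; have Ceta := primitive_C1form He; have [_ curl] := He.
rewrite /sigma iter_pathE (lineint_primitive Ceta (iter_pathP n) curl).
rewrite (lineint_primitive Ceta (iter_pathP 0) curl) (area_iter n gth) !iter_path0 /=.
by lra.
Qed.

End Assembly.

Theorem theorem3p4 (R : realType)
  (* an element of the universal cover of G_o, represented by a smooth path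
     (g_t)_{t in [0,1]} in G_o with g_0 = id, g_t^{-1} = ginv t *)
  (g ginv : R -> R * R -> R * R)
  (Hsmooth : smooth_near (unit_interval `*` disk) (fun z : R * (R * R) => g z.1 z.2))
  (Hsymp : forall t, unit_interval t -> sympD (g t) (ginv t))
  (Hfix : forall t, unit_interval t -> g t origin = origin)
  (Hid : forall p, disk p -> g 0 p = p)
  (* the lift to the universal cover of Diff_+(S^1) of the boundary path *)
  (F : R -> R -> R)
  (HFc : {within unit_interval `*` setT, continuous (fun z : R * R => F z.1 z.2)})
  (HF0 : forall th, F 0 th = th)
  (HFlift : forall t th, unit_interval t ->
     g t (cos th, sin th) = (cos (F t th), sin (F t th)))
  (* any primitive eta of omega, any path gamma from o to the boundary *)
  (eta : R * R -> R * R) (Heta : primitive_omega eta)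
  (gamma : R -> R * R)
  (Hgam : smooth_near unit_interval gamma)
  (HgamD : forall s, unit_interval s -> disk (gamma s))
  (Hgam0 : gamma 0 = origin) (Hgam1 : circle (gamma 1)) :
  sigma_bar eta gamma (g 1) - S_path gamma g ginv = pi * transl_number (F 1).
Proof.
have I1 : 0 <= (1 : R) <= 1 by rewrite lexx ler01.
have pi20 : 0 < pi *+ 2 :> R by rewrite pmulrn_lgt0 // pi_gt0.
have [th gth] := circleP Hgam1.
have F1 x : F 1 (x + pi *+ 2) = F 1 x + pi *+ 2 := lift_degree1 Hsmooth HFc HF0 HFlift x I1.
have Fm := lift_homo Hsmooth Hsymp HFc HF0 HFlift.
have /cvg_ex[/= L cL] := translation_cvg pi20 Fm F1.
have -> : transl_number (F 1) = L / (pi *+ 2).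
  apply/cvg_lim => //.
  rewrite (_ : (fun n => _) = (fun n : nat => iter n (F 1) 0 / n%:R * (pi *+ 2)^-1)); last first.
    apply/funext => n; rewrite -[RHS]mulrA; congr (_ * _).
    by rewrite -[pi *+ 2]mulr_natl [LHS]invfM [LHS]mulrC.
  by apply: cvgM => //; exact: cvg_cst.
have [C CP] : exists C : R, forall p, disk p -> `|radial eta p| <= C.
  apply: radial_bounded => p dp; have [de _ _ _ _] := primitive_C1form Heta dp.
  exact: differentiable_continuous.
(* [b] collects all that stays bounded: the end-point terms and the replacement of the orbit of [th]
   by that of 0, which defines the translation number. *)
pose b n : R := (iter n (F 1) th - th - iter n (F 1) 0) / 2 +
   (radial eta (iter_path g gamma n 1) - radial eta (gamma 1)).
have bP n : `|b n| <= pi *+ 2 + (C + C).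
  rewrite (le_trans (ler_normD _ _)) // lerD //.
    rewrite normrM normfV (ger0_norm (ler0n _ 2)) ler_pdivrMr //.
    rewrite (le_trans (iter_degree1 pi20 Fm F1 n th)) //; lra.
  rewrite (le_trans (ler_normB _ _)) // lerD //; apply: CP.
    by rewrite (iter_path1 HFlift n gth); exact/circle_disk/circle_cos_sin.
  exact: circle_disk.
have cb := bounded_over_nat bP.
have -> : sigma_bar eta gamma (g 1) = S_path gamma g ginv + L / 2 + 0.
  apply/cvg_lim => //.
  have cc : (fun n => (S_path gamma g ginv + iter n (F 1) 0 / n%:R / 2) + b n / n%:R) @ \oo
      --> S_path gamma g ginv + L / 2 + 0.
    apply: cvgD => //; apply: cvgD; first exact: cvg_cst.
    by apply: cvgM => //; exact: cvg_cst.
  (* The two sequences are compared from n = 1 on, since at 0 the quotient of [n%:R * S_path] by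
     [n%:R] is not [S_path]. *)
  apply: cvg_trans cc; apply: near_eq_cvg; exists 1%N => // n /= n0.
  rewrite (sigma_iter Hsmooth Hsymp Hfix Hid HFc HF0 HFlift Hgam HgamD Hgam0 Hgam1 n Heta gth) /b.
  by field; rewrite pnatr_eq0 -lt0n.
have p0 : pi != 0 :> R by rewrite gt_eqF // pi_gt0.
(* Half the mean displacement against the normalisation by a full turn 2 pi, with pi replaced by a
   generic nonzero number. *)
have E (p : R) : p != 0 -> L / 2 = p * (L / (p *+ 2)) by move=> p1; field.
by rewrite -(E _ p0) addr0 [_ + L / 2]addrC addrK.
Qed.
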